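(* Let $b(n)$, $n\ge 1$, be positive numbers such that $b(n)\to\infty$ and $\frac{\mu(n)}{b(n)}\to\infty$ as $n\to\infty$. Let $$Z_n:=\frac{R_n-\mu(n)}{\sqrt{\mu(n)b(n)}}.$$ If $\pi$ is regular with index $\gamma\in(0,1)$, then $\{Z_n\}_{n\ge1}$ satisfies a large deviation principle (with speed $b(n)$) with rate function $I_\gamma(x)=\frac{x^2}{2(2^\gamma-1)}$; precisely, for every measurable set $B\subset\mathbb{R}$, $$-\frac{1}{2(2^\gamma-1)}\inf_{x\in B^o}x^2\le \liminf_{n\to\infty}\frac{1}{b(n)}\log \mathbb{P}(Z_n\in B)\le \limsup_{n\to\infty}\frac{1}{b(n)}\log \mathbb{P}(Z_n\in B)\le -\frac{1}{2(2^\gamma-1)}\inf_{x\in\bar B}x^2 .$$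
   Context: Let $\pi=(\pi_i)_{i\ge 1}$ be a probability measure on $\mathbb{N}=\{1,2,\dots\}$ with $\pi_i\ge \pi_{i+1}>0$ for all $i\ge 1$. Let $\{\xi_n\}_{n\ge 1}$ be i.i.d. random variables with common law $\pi$, and let $R_n:=\#\{\xi_k:1\le k\le n\}$. For $t\ge 0$ put $\mu(t):=\sum_{i=1}^\infty[1-e^{-t\pi_i}]$. A strictly increasing function $\zeta:[0,\infty)\to[0,\infty)$ is called $\gamma$-regular ($\gamma\in[0,1]$) if $\lim_{x\to\infty}\zeta(\lambda x)/\zeta(x)=\lambda^\gamma$ for every $\lambda>0$. For $\gamma\in(0,1)$, $\pi$ is called $\gamma$-regular (regular with index $\gamma$) if there is a $\gamma$-regular function $\zeta$ with $\lim_{n\to\infty}\pi_n\cdot\zeta^{-1}(n)=1$, where $\zeta^{-1}$ is the inverse function of $\zeta$. $B^o$ and $\bar B$ denote the interior and the closure of $B$ in $\mathbb{R}$. Conventions: $\inf\emptyset=+\infty$, $\log 0=-\infty$. *)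

(* Defs.v *)
(* Library: MathComp-Analysis. *)
From HB Require Import structures.
From mathcomp Require Export all_boot all_order all_algebra.
From mathcomp Require Export all_classical all_reals all_analysis.

Set Implicit Arguments.
Unset Strict Implicit.
Unset Printing Implicit Defensive.

Import Order.TTheory GRing.Theory Num.Theory numFieldNormedType.Exports.

Local Open Scope classical_set_scope.
Local Open Scope ring_scope.

(* Laws on {1, 2, ...} are probabilities on the discrete space nat giving mass
   zero to 0, so that all indices start at 1. *)
Definition mass (R : realType) (p : probability nat R) (i : nat) : R :=
  fine (p [set i]).

Definition nonincreasing_positive_law (R : realType) (p : probability nat R)
    : Prop :=
  p [set 0%N] = 0%E /\
  forall i : nat, (1 <= i)%N -> 0 < mass p i.+1 /\ mass p i.+1 <= mass p i.

(* The sum is finite for t >= 0, since 1 - exp (- t p_i) <= t p_i. *)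
Definition mean_occupancy (R : realType) (p : probability nat R) (t : R) : R :=
  fine (\sum_(1 <= i <oo) (1 - expR (- (t * mass p i)))%:E)%E.

Definition mutually_independent d d' (T : measurableType d)
    (T' : measurableType d') (R : realType) (P : probability T R)
    (D : set nat) (X : nat -> {RV P >-> T'}) : Prop :=
  forall J : seq nat, uniq J -> [set` J] `<=` D ->
  forall A : nat -> set T', (forall k, measurable (A k)) ->
    P (\bigcap_(k in [set` J]) (X k @^-1` A k)) =
    (\prod_(k <- J) P (X k @^-1` A k))%E.

(* The value xi 0 plays no role. *)
Definition iid_with_law d (T : measurableType d) (R : realType)
    (P : probability T R) (p : probability nat R)
    (xi : nat -> {RV P >-> nat}) : Prop :=
  mutually_independent [set k | (1 <= k)%N] xi /\
  forall k : nat, (1 <= k)%N ->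
    forall A : set nat, measurable A -> distribution P (xi k) A = p A.

Definition range_count (T : Type) (xi : nat -> T -> nat) (n : nat) (w : T)
    : nat :=
  size (undup [seq xi k w | k <- index_iota 1 n.+1]).

(* A function from [0, +oo) to itself is represented by a function on R whose
   values at negative reals are ignored. *)
Definition regular_function (R : realType) (gamma : R) (zeta : R -> R) : Prop :=
  [/\ forall x, 0 <= x -> 0 <= zeta x,
      forall x y, 0 <= x -> x < y -> zeta x < zeta y &
      forall lambda, 0 < lambda ->
        zeta (lambda * x) / zeta x @[x --> +oo] --> lambda `^ gamma].

(* A strictly increasing zeta need be neither continuous nor onto, so its
   inverse is taken in the generalized sense; on the range of zeta it is the
   inverse in the usual sense (increasing_inverseK). *)
Definition increasing_inverse (R : realType) (zeta : R -> R) (y : R) : R :=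
  inf [set x | 0 <= x /\ y <= zeta x].

Lemma increasing_inverseK (R : realType) (zeta : R -> R) :
  (forall x y, 0 <= x -> x < y -> zeta x < zeta y) ->
  forall x, 0 <= x -> increasing_inverse zeta (zeta x) = x.
Proof.
move=> zinc x x0; apply/eqP; rewrite eq_le; apply/andP; split.
- by apply: ge_inf => //=; exists 0 => y [].
- apply: lb_le_inf; first by exists x.
  move=> y /= [y0 zxy]; rewrite leNgt; apply/negP => yx.
  by have := zinc _ _ y0 yx; rewrite ltNge zxy.
Qed.

Definition regular_law (R : realType) (gamma : R) (p : probability nat R)
    : Prop :=
  exists2 zeta : R -> R, regular_function gamma zeta &
    mass p n * increasing_inverse zeta n%:R @[n --> \oo] --> (1 : R).

Definition Zscaled (T : Type) (R : realType) (p : probability nat R)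
    (b : nat -> R) (xi : nat -> T -> nat) (n : nat) (w : T) : R :=
  ((range_count xi n w)%:R - mean_occupancy p n%:R)
    / Num.sqrt (mean_occupancy p n%:R * b n).

(* Main.v *)
Require Import Defs.
From mathcomp Require Import ring lra measurable_realfun.
Import Order.TTheory GRing.Theory Num.Theory numFieldNormedType.Exports.
Local Open Scope classical_set_scope.
Local Open Scope ring_scope.

(** At a Poisson time of mean t the cells are hit independently, cell i with
    probability q_i = 1 - exp (- t p_i), so that the range is a sum of
    independent Bernoulli variables with mean mu (t) = sum q_i and variance
    sum q_i (1 - q_i) = mu (2 t) - mu (t). Its cumulant generating function at s
    is therefore s mu + s^2 / 2 (mu (2 t) - mu (t)) + O(|s|^3 mu)
    (bernoulli_mgf_bounds). On the scale of Z_n, that is for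
    s = la sqrt (b / mu), the cubic term is o(b), and the centered quadratic term
    is asymptotic to b la^2 v / 2 with v = 2^gamma - 1, as soon as
    mu (2 n) / mu (n) tends to 2^gamma.

    The Poisson time is removed by monotonicity. The law of R_n enters through
    the mean of exp (s R_n), which is monotone in n, and its Poisson average is
    explicit: by inclusion-exclusion it is a finite combination of sequences
    (1 - p S)^n (range_below_mgfE), whose Poisson averages are exp (- t p S)
    (poisson_average_range_below_mgf). A Poisson time t = n (1 + dl) with
    n dl^2 = K^2 b lies on a given side of n up to probability exp (- c K^2 b),
    which is negligible for K large, also against second moments
    (depoissonization_upper, depoissonization_lower). Moving the time from n to t
    changes the mean by at most |dl| mu = o(sqrt (mu b)) because mu is concave and
    mu (n) = o(n). This gives the limit la^2 v / 2 of the normalized logarithm of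
    the moment generating function (mgf_near_upper, mgf_near_lower).

    The doubling limit comes from regular variation. The number of i with
    p_i >= 1 / x is asymptotic to zeta x (count_asymptotics), so that halving the
    level multiplies this count by 2^gamma in the limit (count_ratio). As mu (t)
    is the expectation of the count at an exponentially distributed level of rate
    t, integrating the comparison of counts gives
    mu (2 t) = (2^gamma + o(1)) mu (t) (mean_occupancy_comparison,
    cvg_occupancy_variance_ratio).

    Finally, quadratic limits of the cumulants at every la yield the large
    deviation principle: Chernoff's bound for closed sets, and an exponential
    tilt for open ones (quadratic_ldp_upper_set, quadratic_ldp_lower_set). *)

(** * Exponential inequalities *)

Section ExponentialBounds.
Set Implicit Arguments.
Unset Strict Implicit.
Unset Printing Implicit Defensive.
Variable R : realType.
Implicit Types x s q c : R.

(** The Taylor bounds below follow by integrating 1 + x <= exp x repeatedly. *)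
Lemma is_derive_ge0_le (f f' : R -> R) :
  (forall x, is_derive x 1 f (f' x)) ->
  (forall x, 0 <= x -> 0 <= f' x) -> forall x, 0 <= x -> f 0 <= f x.
Proof.
move=> df f'0 x x0; apply: (@ger0_derive1_le_cc R f 0 x) => //.
- move=> y; rewrite in_itv/= => /andP[y0 _].
  by have dfy := df y; rewrite derive1E derive_val; apply: f'0; exact: ltW.
- apply: continuous_subspaceT => y; apply: differentiable_continuous.
  by have dfy := df y; apply/derivable1_diffP; apply: ex_derive.
- by rewrite in_itv/= lexx.
- by rewrite in_itv/= x0 lexx.
Qed.

Lemma expR_ge_quadratic x : 0 <= x -> 1 + x + x ^+ 2 / 2 <= expR x.
Proof.
move=> x0.
have := @is_derive_ge0_le (fun y => expR y - (1 + y + y ^+ 2 / 2))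
  (fun y => expR y - (1 + y)) _ _ x x0.
rewrite expR0 !addr0 expr0n/= mul0r addr0 subrr subr_ge0; apply.
- move=> y; apply: is_derive_eq; rewrite /GRing.scale/=; by field.
- by move=> y _; rewrite subr_ge0; exact: expR_ge1Dx.
Qed.

Lemma expRN_le_quadratic x : 0 <= x -> expR (- x) <= 1 - x + x ^+ 2 / 2.
Proof.
move=> x0.
have := @is_derive_ge0_le (fun y => (1 - y + y ^+ 2 / 2) - expR (- y))
  (fun y => expR (- y) - (1 - y)) _ _ x x0.
rewrite oppr0 expR0 !addr0 expr0n/= mul0r addr0 subrr subr_ge0; apply.
- move=> y; apply: is_derive_eq; rewrite /GRing.scale/=; by field.
- by move=> y _; rewrite subr_ge0; exact: expR_ge1Dx.
Qed.

Lemma expR_ge_cubic x : 1 + x + x ^+ 2 / 2 + x ^+ 3 / 6 <= expR x.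
Proof.
have [x0|/ltW x0] := leP 0 x.
  have := @is_derive_ge0_le (fun y => expR y - (1 + y + y ^+ 2 / 2 + y ^+ 3 / 6))
    (fun y => expR y - (1 + y + y ^+ 2 / 2)) _ _ x x0.
  rewrite expR0 !addr0 !expr0n/= !mul0r !addr0 subrr subr_ge0; apply.
  - move=> y; apply: is_derive_eq; rewrite /GRing.scale/=; by field.
  - by move=> y y0; rewrite subr_ge0; exact: expR_ge_quadratic.
have := @is_derive_ge0_le
  (fun y => expR (- y) - (1 - y + y ^+ 2 / 2 - y ^+ 3 / 6))
  (fun y => (1 - y + y ^+ 2 / 2) - expR (- y)) _ _ (- x).
rewrite oppr0 expR0 !addr0 !expr0n/= !mul0r !oppr0 !addr0 subrr subr_ge0 opprK.
have -> : 1 + x + (- x) ^+ 2 / 2 - (- x) ^+ 3 / 6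
   = 1 + x + x ^+ 2 / 2 + x ^+ 3 / 6 by field.
apply.
- move=> y; apply: is_derive_eq; rewrite /GRing.scale/=; by field.
- by move=> y y0; rewrite subr_ge0; exact: expRN_le_quadratic.
- by rewrite oppr_ge0.
Qed.

Lemma expR_le_cubic x : `|x| <= 1 -> expR x <= 1 + x + x ^+ 2 / 2 + `|x| ^+ 3.
Proof.
have [x0 x1|x0 _] := leP 0 x; last first.
  have := @expRN_le_quadratic (- x); rewrite opprK sqrrN oppr_ge0 ltW// => /(_ isT).
  by move=> /le_trans; apply; rewrite lerDl exprn_ge0// ltW// oppr_gt0.
have e0 := expR_gt0 (- x).
have := expR_ge_cubic (- x); rewrite -(ler_pM2r (expR_gt0 x)) -expRD addNr expR0.
set a := (X in X * _); set z := expR x => az.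
have z0 : 0 < z by exact: expR_gt0.
(* the upper bound is the inverse of the lower bound a at - x *)
suff ab : 1 <= a * (1 + x + x ^+ 2 / 2 + x ^+ 3).
  have a0 : 0 < a.
    rewrite /a; move: x1; rewrite ger0_norm// => x1.
    have x3 : 0 <= x ^+ 3 by exact: exprn_ge0.
    have : x ^+ 3 <= x ^+ 2 by rewrite exprS; nra.
    rewrite !sqrrN; nra.
  by rewrite -(ler_pM2l a0) (le_trans az)// ger0_norm.
rewrite /a -subr_ge0.
have -> : (1 - x + (- x) ^+ 2 / 2 + (- x) ^+ 3 / 6) * (1 + x + x ^+ 2 / 2 + x ^+ 3) - 1
  = x ^+ 3 * (5 / 6 - 11 / 12 * x + 5 / 12 * x ^+ 2 - x ^+ 3 / 6) by field.
apply: mulr_ge0; first exact: exprn_ge0.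
move: x1; rewrite ger0_norm// => x1.
have : x ^+ 3 <= x ^+ 2 by rewrite exprS; have := exprn_ge0 2 x0; nra.
nra.
Qed.

(** Second-order expansion of the cumulant generating function of a Bernoulli
    variable: its mean is q and its variance q (1 - q), and the error is of
    third order in s but still linear in q, hence summable over the cells. *)
Lemma bernoulli_mgf_bounds q s : 0 <= q <= 1 -> `|s| <= 10^-1 ->
  let m := q * s + q * (1 - q) * (s ^+ 2 / 2) in
  let e := q * (3 * `|s| ^+ 3) in
  expR (m - e) <= 1 + q * (expR s - 1) /\
  1 + q * (expR s - 1) <= expR (m + e).
Proof.
move=> /andP[q0 q1] sa m e.
set a := `|s| in sa e *.
have a0 : 0 <= a by exact: normr_ge0.
have s2 : s ^+ 2 = a ^+ 2 by rewrite /a real_normK// num_real.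
have sle : - a <= s <= a by rewrite -ler_norml.
have a3 : 0 <= a ^+ 3 by exact: exprn_ge0.
have a3q : 0 <= q * a ^+ 3 by exact: mulr_ge0.
have q2 : q ^+ 2 <= q by nra.
have q3 : q ^+ 3 <= q by rewrite exprS; nra.
have a2q : 0 <= q * a ^+ 2 by rewrite mulr_ge0// exprn_ge0.
have e_le : e <= 3 / 10 * (q * a ^+ 2).
  by rewrite /e exprS; nra.
have e0 : 0 <= e by rewrite /e; lra.
have v0 : 0 <= q * (1 - q) * (s ^+ 2 / 2) <= 1 / 2 * (q * a ^+ 2).
  by rewrite s2; apply/andP; split; nra.
(* both exponents have the form q s + r with r of second order, so that their
   squares are q^2 s^2 up to third order *)
have key r : `|r| <= 4 / 5 * (q * a ^+ 2) -> let y := q * s + r in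
    [/\ `|y| <= 1, `|y ^+ 2 - q ^+ 2 * a ^+ 2| <= 1664 / 1000 * (q * a ^+ 3)
      & `|y| ^+ 3 <= 13 / 10 * (q * a ^+ 3)].
  move=> rl y.
  have aq0 : 0 <= q * a by exact: mulr_ge0.
  have rb : `|r| <= 8 / 100 * (q * a) by nra.
  have yb : `|y| <= 108 / 100 * (q * a).
    rewrite (le_trans (ler_normD _ _))// normrM (ger0_norm q0) -/a.
    by move: rb; lra.
  split; first by nra.
  - have -> : y ^+ 2 - q ^+ 2 * a ^+ 2 = 2 * (q * s) * r + r ^+ 2.
      by rewrite -s2 /y; ring.
    rewrite (le_trans (ler_normD _ _))// normrX !normrM (ger0_norm q0) -/a.
    have -> : `|2 : R| = 2 by rewrite ger0_norm.
    have r0 := normr_ge0 r.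
    have h1 : 2 * (q * a) * `|r| <= 8 / 5 * (q ^+ 2 * a ^+ 3).
      have -> : 8 / 5 * (q ^+ 2 * a ^+ 3) = 2 * (q * a) * (4 / 5 * (q * a ^+ 2)) by field.
      by apply: ler_wpM2l => //; lra.
    have h2 : `|r| ^+ 2 <= 64 / 1000 * (q ^+ 2 * a ^+ 3).
      have -> : 64 / 1000 * (q ^+ 2 * a ^+ 3)
        = 8 / 100 * (q * a) * (4 / 5 * (q * a ^+ 2)) by field.
      by rewrite expr2; apply: ler_pM.
    have h3 : q ^+ 2 * a ^+ 3 <= q * a ^+ 3 by apply: ler_wpM2r.
    lra.
  - have : `|y| ^+ 3 <= (108 / 100 * (q * a)) ^+ 3.
      by apply: lerXn2r => //; rewrite nnegrE//; lra.
    have -> : (108 / 100 * (q * a)) ^+ 3 = (108 / 100) ^+ 3 * (q ^+ 3 * a ^+ 3).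
      by field.
    have : q ^+ 3 * a ^+ 3 <= q * a ^+ 3 by apply: ler_wpM2r.
    lra.
have s1 : `|s| <= 1 by apply: le_trans sa _; lra.
split.
- have [|y1 y2 y3] := key (q * (1 - q) * (s ^+ 2 / 2) - e).
    by rewrite ler_norml; lra.
  rewrite -[q * s + _]/(q * s + (q * (1 - q) * (s ^+ 2 / 2) - e)) addrA -/m in y1 y2 y3.
  apply: le_trans (expR_le_cubic y1) _.
  have := expR_ge_cubic s.
  have s3 : - a ^+ 3 <= s ^+ 3.
    by rewrite /a -normrX lerNl -normrN ler_norm.
  have := ler_norm ((m - e) ^+ 2 - q ^+ 2 * a ^+ 2).
  move: y2 y3; rewrite /m /e s2; nra.
- have [|y1 y2 y3] := key (q * (1 - q) * (s ^+ 2 / 2) + e).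
    by rewrite ler_norml; lra.
  rewrite -[q * s + _]/(q * s + (q * (1 - q) * (s ^+ 2 / 2) + e)) addrA -/m in y1 y2 y3.
  apply: le_trans (expR_ge_cubic (m + e)).
  have /(ler_wpM2l q0) : expR s - 1 <= s + s ^+ 2 / 2 + a ^+ 3.
    by have := expR_le_cubic s1; rewrite -/a; lra.
  have s3 : - `|m + e| ^+ 3 <= (m + e) ^+ 3.
    by rewrite -normrX lerNl -normrN ler_norm.
  have := ler_norm (- ((m + e) ^+ 2 - q ^+ 2 * a ^+ 2)); rewrite normrN.
  move: y2 y3 s3; move: (`|m + e|) ((m + e) ^+ 3) ((m + e) ^+ 2) => u v w.
  by rewrite /m /e s2; lra.
Qed.

(** Concavity of x |-> 1 - exp (- x), from the tangent line at c x. *)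
Lemma one_minus_expRN_concave c x : 0 <= c <= 1 ->
  c * (1 - expR (- x)) <= 1 - expR (- (c * x)).
Proof.
move=> /andP[c0 c1].
have e0 := expR_gt0 (- (c * x)).
have h1 : expR (- (c * x)) * (1 + c * x) <= 1.
  rewrite -[leRHS](_ : expR (- (c * x)) * expR (c * x) = 1).
    by rewrite ler_pM2l//; exact: expR_ge1Dx.
  by rewrite -expRD addNr expR0.
have h2 : expR (- (c * x)) * (1 + (c * x - x)) <= expR (- x).
  rewrite [leRHS](_ : _ = expR (- (c * x)) * expR (c * x - x)).
    by rewrite ler_pM2l//; exact: expR_ge1Dx.
  by rewrite -expRD; congr expR; ring.
nra.
Qed.

(** The exponent in Chernoff's bound for a Poisson variable of mean 1 + d
    crossing the level 1 (per unit of time); one inequality serves both tails,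
    according to the sign of d. *)
Lemma poisson_chernoff_exponent (d : R) : `|d| <= 2^-1 ->
  d / 2 + (1 + d) * (expR (- (d / 2)) - 1) <= - (d ^+ 2 / 8).
Proof.
move=> dle; have /andP[d1 d2] : - 2^-1 <= d <= 2^-1 by rewrite -ler_norml.
have u : `|- (d / 2)| <= 4^-1.
  by rewrite ler_norml; lra.
have u1 : `|- (d / 2)| <= 1 by apply: le_trans u _; lra.
have := expR_le_cubic u1.
have : `|- (d / 2)| ^+ 3 <= 4^-1 * (d / 2) ^+ 2.
  rewrite exprS -(sqrrN (d / 2)) -[X in _ <= _ * X]real_normK ?num_real//.
  by apply: ler_wpM2r => //; exact: exprn_ge0.
set e := expR _; nra.
Qed.

End ExponentialBounds.

(** * Poisson averages of sequences *)

Section Depoissonization.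
Set Implicit Arguments.
Unset Strict Implicit.
Unset Printing Implicit Defensive.
Variable R : realType.
Implicit Types (f g : R^nat) (t l r : R).

Definition poisson_average t f l : Prop :=
  series (fun m => expR (- t) * exp_coeff t m * f m) @ \oo --> l.

Lemma poisson_average_geometric t r :
  poisson_average t (fun m => r ^+ m) (expR (t * (r - 1))).
Proof.
rewrite /poisson_average.
have -> : (fun m => expR (- t) * exp_coeff t m * r ^+ m)
    = (fun m => expR (- t) *: exp_coeff (t * r) m).
  by apply/funext => m; rewrite /exp_coeff/= exprMn /GRing.scale/=; ring.
have -> : expR (t * (r - 1)) = expR (- t) *: expR (t * r).
  by rewrite /GRing.scale/= -expRD; congr expR; ring.
rewrite (_ : series _ = (fun n => expR (- t) *: series (exp_coeff (t * r)) n)).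
  by apply: cvgZr; exact: is_cvg_series_exp_coeff.
by apply/funext => n; rewrite /series/= scaler_sumr.
Qed.

Arguments poisson_average_geometric : clear implicits.

Lemma poisson_averageD t f g l l' :
  poisson_average t f l -> poisson_average t g l' ->
  poisson_average t (fun m => f m + g m) (l + l').
Proof.
rewrite /poisson_average => fl gl.
rewrite (_ : series _ = series (fun m => expR (- t) * exp_coeff t m * f m)
  \+ series (fun m => expR (- t) * exp_coeff t m * g m)); first exact: cvgD.
apply/funext => n; rewrite /series/= -big_split/=.
by apply: eq_bigr => i _; rewrite mulrDr.
Qed.

Lemma poisson_averageZ t c f l :
  poisson_average t f l -> poisson_average t (fun m => c * f m) (c * l).
Proof.
rewrite /poisson_average => fl.
rewrite (_ : series _ =
  (fun n => c *: series (fun m => expR (- t) * exp_coeff t m * f m) n)).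
  exact: cvgZr.
by apply/funext => n; rewrite /series/= scaler_sumr; apply: eq_bigr => i _;
  rewrite /GRing.scale/=; ring.
Qed.

Arguments poisson_averageZ {t} c {f l} _.

Lemma poisson_average_sum t (I : finType) (f : I -> R^nat) (l : I -> R) :
  (forall i, poisson_average t (f i) (l i)) ->
  poisson_average t (fun m => \sum_i f i m) (\sum_i l i).
Proof.
move=> fl; rewrite /poisson_average.
rewrite (_ : series _ =
  (fun n => \sum_i series (fun m => expR (- t) * exp_coeff t m * f i m) n)).
  by apply: cvg_big => [|i _]; [exact: add_continuous|exact: fl].
apply/funext => n; rewrite /series/= exchange_big/=.
by apply: eq_bigr => i _; rewrite mulr_sumr.
Qed.

Lemma poisson_average_le t f g l l' : 0 <= t -> (forall m, f m <= g m) ->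
  poisson_average t f l -> poisson_average t g l' -> l <= l'.
Proof.
move=> t0 fg fl gl; apply: ler_cvg_to fl gl _.
near=> n; rewrite /series/=; apply: ler_sum => i _; apply: ler_wpM2l => //.
by rewrite mulr_ge0 ?expR_ge0// exp_coeff_ge0.
Unshelve. all: by end_near. Qed.

Lemma poisson_average_expR t eta n :
  poisson_average t (fun m => expR (eta * (m%:R - n%:R)))
    (expR (- (eta * n%:R) + t * (expR eta - 1))).
Proof.
rewrite expRD (_ : (fun m => _) = (fun m => expR (- (eta * n%:R)) * expR eta ^+ m)).
  by apply: poisson_averageZ; exact: poisson_average_geometric.
by apply/funext => m; rewrite -expRM_natr -expRD; congr expR; ring.
Qed.

Arguments poisson_average_expR : clear implicits.

(** A Poisson average of a monotone sequence controls its n-th term. The sign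
    of eta tells the direction of monotonicity: eta (m - n) >= 0 says that m
    lies on the side of n where f exceeds f n. On the other side the factor
    1 - exp (- eta (m - n)) is nonpositive, so that it can stand for the
    indicator of the good side. *)
Lemma depoissonization_upper t f l n eta : 0 <= t -> (forall m, 0 <= f m) ->
  (forall m, 0 <= eta * (m%:R - n%:R) -> f n <= f m) ->
  poisson_average t f l ->
  f n * (1 - expR (eta * n%:R + t * (expR (- eta) - 1))) <= l.
Proof.
move=> t0 f0 fmono fl.
have := poisson_averageD (poisson_average_geometric t 1)
  (poisson_averageZ (-1) (poisson_average_expR t (- eta) n)).
move=> /(poisson_averageZ (f n)).
rewrite subrr mulr0 expR0 mulN1r (mulNr eta) opprK => h.
apply: poisson_average_le t0 _ h fl => m.
rewrite expr1n mulN1r.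
have [mn|mn] := leP 0 (eta * (m%:R - n%:R)).
  apply: le_trans (fmono _ mn).
  by rewrite ler_piMr// gerBl expR_ge0.
apply: le_trans (f0 m); apply: mulr_ge0_le0 => //.
rewrite subr_le0 -[leLHS]expR0 ler_expR; lra.
Qed.

(** Beyond n the sequence is not controlled by f n; there the elementary bound
    2 f <= A + f^2 / A splits it into a term killed by the Poisson tail and a
    second moment made small by the choice of A. *)
Lemma depoissonization_lower t f g l l' n eta A : 0 <= t -> 0 < A ->
  (forall m, 0 <= f m) -> (forall m, f m ^+ 2 <= g m) ->
  (forall m, eta * (m%:R - n%:R) <= 0 -> f m <= f n) ->
  poisson_average t f l -> poisson_average t g l' ->
  l <= f n + A / 2 * expR (- (eta * n%:R) + t * (expR eta - 1)) + l' / (2 * A).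
Proof.
move=> t0 A0 f0 fg fmono fl gl.
have := poisson_averageD (poisson_averageD
  (poisson_averageZ (f n) (poisson_average_geometric t 1))
  (poisson_averageZ (A / 2) (poisson_average_expR t eta n)))
  (poisson_averageZ (2 * A)^-1 gl).
rewrite subrr mulr0 expR0 mulr1 [_ * l']mulrC => h.
apply: poisson_average_le t0 _ fl h => m.
rewrite expr1n mulr1.
have g0 : 0 <= g m by apply: le_trans (fg m); exact: sqr_ge0.
have g0' : 0 <= (2 * A)^-1 * g m by rewrite mulr_ge0// invr_ge0; lra.
have [mn|mn] := leP (eta * (m%:R - n%:R)) 0.
  rewrite -addrA (le_trans (fmono _ mn))// lerDl addr_ge0//.
  by rewrite mulr_ge0 ?expR_ge0//; lra.
have e1 : 1 <= expR (eta * (m%:R - n%:R)) by rewrite -[leLHS]expR0 ler_expR ltW.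
apply: (@le_trans _ _ (A / 2 + (2 * A)^-1 * f m ^+ 2)).
  have -> : A / 2 + (2 * A)^-1 * f m ^+ 2 = f m + (A - f m) ^+ 2 / (2 * A).
    by field; rewrite gt_eqF.
  by rewrite lerDl divr_ge0 ?sqr_ge0//; lra.
apply: lerD; last by rewrite ler_wpM2l// invr_ge0; lra.
by have := f0 n; nra.
Qed.

End Depoissonization.

(** * The range of an independent sample *)

Section TruncatedRange.
Set Implicit Arguments.
Unset Strict Implicit.
Unset Printing Implicit Defensive.
Variables (T : Type) (xi : nat -> T -> nat).
Implicit Types (n I : nat) (w : T).

Definition visited n w (i : nat) : bool :=
  i \in [seq xi k w | k <- index_iota 1 n.+1].

(** Truncation to the cells below I keeps all expansions finite; the bounds
    pass to the limit as I grows. Cell 0 may be included since it has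
    mass 0. *)
Definition range_count_below I n w : nat := (\sum_(i < I) visited n w i)%N.

Lemma range_count_belowE I n w : range_count_below I n w =
  count (fun i => (i < I)%N) (undup [seq xi k w | k <- index_iota 1 n.+1]).
Proof.
rewrite /range_count_below /visited; set s := map _ _.
rewrite -(big_mkord xpredT (fun i => (i \in s : nat))) /index_iota subn0.
transitivity (count (mem s) (iota 0 I)).
  rewrite -sum1_count [RHS]big_mkcond; apply: eq_bigr => i _ /=.
  by case: (i \in s).
rewrite -!size_filter; apply/perm_size/uniq_perm.
- exact/filter_uniq/iota_uniq.
- exact/filter_uniq/undup_uniq.
- by move=> i; rewrite !mem_filter mem_undup mem_iota add0n leq0n /= andbC.
Qed.

Lemma range_count_le n w : (range_count xi n w <= n)%N.
Proof.
rewrite /range_count (leq_trans (size_undup _))// size_map size_iota.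
by rewrite subSS subn0.
Qed.

Lemma range_count_below_le I n w : (range_count_below I n w <= n)%N.
Proof.
rewrite range_count_belowE (leq_trans (count_size _ _))//.
exact: range_count_le.
Qed.

Lemma range_count_below_eventually n w :
  \forall I \near \oo, range_count_below I n w = range_count xi n w.
Proof.
near=> I; rewrite range_count_belowE /range_count; apply/eqP.
rewrite -all_count; apply/allP => i; rewrite mem_undup => iw.
have : (\max_(j <- [seq xi k w | k <- index_iota 1 n.+1]) j < I)%N.
  by near: I; exact: nbhs_infty_gt.
by apply: leq_ltn_trans; exact: leq_bigmax_seq.
Unshelve. all: by end_near. Qed.

Lemma range_count_below_mono I w : {homo range_count_below I ^~ w : m n / (m <= n)%N}.
Proof.
move=> m n mn; apply: leq_sum => i _.
rewrite /visited; case: (boolP (_ \in [seq _ | _ <- index_iota 1 m.+1])) => //.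
move=> /mapP[k km ->]; rewrite map_f//.
by move: km; rewrite !mem_index_iota => /andP[-> /=]; move/leq_trans; apply.
Qed.

Lemma expR_range_count_below (R : realType) (s : R) I n w :
  expR (s * (range_count_below I n w)%:R) =
  \prod_(i < I) (expR s + (1 - expR s) * (~~ visited n w i)%:R).
Proof.
rewrite natr_sum mulr_sumr expR_sum; apply: eq_bigr => i _.
by case: visited => /=; rewrite ?(mulr1, mulr0, expR0, addr0)//; ring.
Qed.

End TruncatedRange.

Section RangeMgf.
Set Implicit Arguments.
Unset Strict Implicit.
Unset Printing Implicit Defensive.
Context (R : realType) (d : measure_display) (T : measurableType d).
Variables (P : probability T R) (p : probability nat R).
Variable xi : nat -> {RV P >-> nat}.
Hypothesis hxi : iid_with_law p xi.
Implicit Types (n I : nat) (w : T) (s t : R).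

Lemma bounded_integrable (f : T -> R) (M : R) : measurable_fun setT f ->
  (forall w, `|f w| <= M) -> P.-integrable setT (EFin \o f).
Proof.
move=> mf fM; apply: measurable_bounded_integrable => //.
  by apply: le_lt_trans (ltry 1); exact: probability_le1.
exists M; split; first exact: num_real.
by move=> x Mx w _ /=; apply: le_trans (fM w) _; exact: ltW.
Qed.

Lemma visited_measurable n i : measurable [set w | visited xi n w i].
Proof.
have -> : [set w | visited xi n w i] =
    \bigcup_(k in [set` index_iota 1 n.+1]) (xi k @^-1` [set i]).
  apply/seteqP; split=> [w /mapP[k kn ->]|w [k kn <-]].
    by exists k.
  by apply: map_f.
by apply: bigcup_measurable => k _; exact: measurable_funPTI.
Qed.

Lemma measurable_range_count_below I n :
  measurable_fun setT (fun w => (range_count_below xi I n w)%:R : R).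
Proof.
rewrite /range_count_below; under eq_fun do rewrite natr_sum.
apply: measurable_sum => i.
rewrite (_ : (fun _ => _) = \1_[set w | visited xi n w i]); last first.
  apply/funext => w; rewrite indicE; congr (_%:R); congr nat_of_bool.
  by apply/idP/idP; rewrite inE.
by apply: measurable_indic; exact: visited_measurable.
Qed.

Lemma measurable_range_count n :
  measurable_fun setT (fun w => (range_count xi n w)%:R : R).
Proof.
apply: (measurable_fun_cvg (h := fun I w => (range_count_below xi I n w)%:R)).
  by move=> I; exact: measurable_range_count_below.
move=> w _; apply: cvg_near_cst.
near=> I; congr (_%:R); near: I.
exact: range_count_below_eventually.
Unshelve. all: by end_near. Qed.

Lemma expR_count_bound s (m n : nat) : (m <= n)%N ->
  `|expR (s * m%:R)| <= expR (`|s| * n%:R).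
Proof.
move=> mn; rewrite ger0_norm ?expR_ge0// ler_expR.
apply: le_trans (ler_norm _) _; rewrite normrM ler_wpM2l// ger0_norm//.
by rewrite ler_nat.
Qed.

Definition range_mgf n s : R := \int[P]_w expR (s * (range_count xi n w)%:R).

Definition range_below_mgf I n s : R :=
  \int[P]_w expR (s * (range_count_below xi I n w)%:R).

Lemma integrable_range_mgf n s :
  P.-integrable setT (fun w => (expR (s * (range_count xi n w)%:R))%:E).
Proof.
apply: (@bounded_integrable _ (expR (`|s| * n%:R))).
  apply: measurableT_comp => //; apply: measurable_funM => //.
  exact: measurable_range_count.
by move=> w; apply: expR_count_bound; exact: range_count_le.
Qed.

Lemma integrable_range_below_mgf I n s :
  P.-integrable setT (fun w => (expR (s * (range_count_below xi I n w)%:R))%:E).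
Proof.
apply: (@bounded_integrable _ (expR (`|s| * n%:R))).
  apply: measurableT_comp => //; apply: measurable_funM => //.
  exact: measurable_range_count_below.
by move=> w; apply: expR_count_bound; exact: range_count_below_le.
Qed.

Lemma range_below_mgf_ge0 I n s : 0 <= range_below_mgf I n s.
Proof. by apply: Rintegral_ge0 => w _; exact: expR_ge0. Qed.

Lemma range_below_mgf_mono I m n s : 0 <= s * (n%:R - m%:R) ->
  range_below_mgf I m s <= range_below_mgf I n s.
Proof.
move=> smn; apply: le_Rintegral => //.
- exact: integrable_range_below_mgf.
- exact: integrable_range_below_mgf.
move=> w _; rewrite ler_expR.
have [s0|s0|->] := ltgtP s 0; last by rewrite !mul0r.
- rewrite ler_nM2l// ler_nat; apply: range_count_below_mono.
  by rewrite -(ler_nat R) -subr_le0 -(nmulr_rge0 _ s0).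
- rewrite ler_pM2l// ler_nat; apply: range_count_below_mono.
  by rewrite -(ler_nat R) -subr_ge0 -(pmulr_rge0 _ s0).
Qed.

(** Jensen's inequality, as the variance of exp (s R) is nonnegative. *)
Lemma range_below_mgf_sqr I n s :
  range_below_mgf I n s ^+ 2 <= range_below_mgf I n (2 * s).
Proof.
set m := range_below_mgf I n s.
have h : 0 <= \int[P]_w (expR ((2 * s) * (range_count_below xi I n w)%:R)
    - (2 * m) * expR (s * (range_count_below xi I n w)%:R) + m ^+ 2).
  apply: Rintegral_ge0 => w _.
  have -> : expR (2 * s * (range_count_below xi I n w)%:R) =
      expR (s * (range_count_below xi I n w)%:R) ^+ 2.
    by rewrite -mulrA expRM_natl.
  set e := expR _; have := sqr_ge0 (e - m); lra.
have i1 := integrable_range_below_mgf I n (2 * s).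
have i2 := integrable_range_below_mgf I n s.
have i3 : P.-integrable setT (fun w : T => (m ^+ 2)%:E).
  by apply: (@bounded_integrable (cst (m ^+ 2)) (`|m ^+ 2|)).
have i4 : P.-integrable setT
    (fun w => (2 * m * expR (s * (range_count_below xi I n w)%:R))%:E).
  exact: (integrableZl _ _ i2).
rewrite RintegralD// in h; last exact: (integrableB _ i1 i4).
rewrite RintegralB// RintegralZl// Rintegral_cst// in h.
have PT : fine (P [set: T]) = 1 by rewrite (@probability_setT _ _ _ P).
rewrite PT mulr1 in h.
have {}h : 0 <= range_below_mgf I n (2 * s) - 2 * m * m + m ^+ 2 := h.
lra.
Qed.

Lemma range_below_mgf_cvg n s :
  range_below_mgf I n s @[I --> \oo] --> range_mgf n s.
Proof.
have [|||||_ _] := @dominated_convergence _ _ _ P setT measurableT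
  (fun I w => (expR (s * (range_count_below xi I n w)%:R))%:E)
  (fun w => (expR (s * (range_count xi n w)%:R))%:E)
  (fun w => (expR (`|s| * n%:R))%:E).
- by move=> I; have /integrableP[] := integrable_range_below_mgf I n s.
- by have /integrableP[] := integrable_range_mgf n s.
- apply: aeW => w _; apply: cvg_near_cst.
  near=> I; congr (expR (s * _%:R))%:E; near: I.
  exact: range_count_below_eventually.
- by apply: (@bounded_integrable (cst (expR (`|s| * n%:R))) (`|expR (`|s| * n%:R)|)).
- apply: aeW => w I _; rewrite /= lee_fin.
  by apply: expR_count_bound; exact: range_count_below_le.
- move=> h; apply: fine_cvg; rewrite fineK//.
  by apply: integrable_fin_num => //; exact: integrable_range_mgf.
Unshelve. all: by end_near. Qed.

Lemma probability_avoid (S : set nat) n :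
  P (\bigcap_(k in [set` index_iota 1 n.+1]) (xi k @^-1` (~` S))) =
  ((1 - fine (p S)) ^+ n)%:E.
Proof.
have mS : measurable S by [].
have [ind law] := hxi.
rewrite (ind _ (iota_uniq _ _) _ (fun=> ~` S)); last by move=> k; exact: measurableC.
  rewrite big_seq (eq_bigr (fun=> (1 - fine (p S))%:E)).
    rewrite -big_seq -[RHS](_ : (\prod_(k <- index_iota 1 n.+1) (1 - fine (p S)))%:E = _).
      by rewrite prodEFin.
    by rewrite big_const_seq count_predT size_iota subSS subn0 iter_mulr_1.
  move=> k; rewrite mem_index_iota => /andP[k1 _].
  have -> : P (xi k @^-1` (~` S)) = distribution P (xi k) (~` S) by [].
  rewrite law//.
  rewrite probability_setC// EFinB fineK//; exact: fin_num_measure.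
by move=> k /=; rewrite mem_index_iota => /andP[].
Qed.

Lemma fine_measure_ord I (A : {pred 'I_I}) :
  fine (p [set x : nat | exists2 i : 'I_I, i \in A & x = i]) =
  \sum_(i < I | i \in A) mass p i.
Proof.
have -> : [set x : nat | exists2 i : 'I_I, i \in A & x = i] =
    \big[setU/set0]_(i < I | i \in A) [set (i : nat)].
  by rewrite -bigcup_pred; apply/seteqP; split=> [x [i iA ->]|x [i iA ->]]; exists i.
rewrite measure_bigsetU_ord//.
  rewrite (eq_bigr (fun i : 'I_I => (mass p i)%:E)) ?sumEFin// => i _.
  by rewrite /mass fineK//; exact: fin_num_measure.
by move=> i j _ _ [k [/= -> /ord_inj]].
Qed.

(** The inclusion-exclusion expansion of the product of the factors
    1 + (e^s - 1) 1_{i visited}: the law of R_n enters only through the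
    probabilities (1 - p S)^n of avoiding finite sets S, which are geometric
    in n. *)
Lemma range_below_mgfE I n s : range_below_mgf I n s =
  \sum_(J : {set 'I_I}) (\prod_i (if i \in J then expR s else 1 - expR s)) *
    (1 - \sum_(i < I | i \in ~: J) mass p i) ^+ n.
Proof.
pose S (J : {set 'I_I}) := [set x : nat | exists2 i : 'I_I, i \in ~: J & x = i].
pose A J := \bigcap_(k in [set` index_iota 1 n.+1]) (xi k @^-1` (~` S J)).
have mA J : measurable (A J).
  apply: fin_bigcap_measurable; first exact: finite_seq.
  by move=> k _; apply: measurable_funPTI; exact: measurableC.
pose c (J : {set 'I_I}) := \prod_i (if i \in J then expR s else 1 - expR s).
have expand w : expR (s * (range_count_below xi I n w)%:R) =
    \sum_(J : {set 'I_I}) c J * \1_(A J) w.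
  rewrite expR_range_count_below bigA_distr/=; apply: eq_bigr => J _.
  rewrite indicE /c; case: (boolP (w \in A J)) => wA /=.
    rewrite mulr1; apply: eq_bigr => i _; case: ifPn => // iJ.
    rewrite (_ : ~~ visited xi n w i) ?mulr1//.
    apply/negP => /mapP[k kn ikw].
    by move: wA; rewrite inE => /(_ k kn) /=; apply; exists i; rewrite ?inE.
  (* some cell outside J is visited, which kills its factor *)
  rewrite mulr0; apply/eqP/prodf_eq0.
  move: wA; rewrite notin_setE => /existsNP[k /not_implyP[kn /contrapT]].
  move=> [i iJ xki]; exists i => //; rewrite inE in iJ; rewrite (negbTE iJ).
  rewrite (_ : visited xi n w i) ?mulr0//.
  by apply/mapP; exists k.
rewrite /range_below_mgf /Rintegral.
under eq_integral => w _ do rewrite expand -sumEFin.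
rewrite integral_sum//=; last first.
  move=> J; under eq_fun do rewrite EFinM.
  by apply: integrableZl => //; exact: integrable_indic.
rewrite (eq_bigr (fun J : {set 'I_I} =>
    (c J * (1 - \sum_(i < I | i \in ~: J) mass p i) ^+ n)%:E)).
  by rewrite sumEFin.
move=> J _; under eq_integral do rewrite EFinM.
rewrite integralZl//; last exact: integrable_indic.
rewrite integral_indic// setIT EFinM; congr (_ * _)%E.
by rewrite -fine_measure_ord; exact: probability_avoid.
Qed.

(** The probability that cell i receives a point when the sample size is Poisson
    of mean t. *)
Definition occupancy t (i : nat) : R := 1 - expR (- (t * mass p i)).

(** Sampling at a Poisson time makes the cells independent: the average of
    (1 - p S)^n is exp (- t p S), which is a product over S, so that the
    expansion refolds into a product over the cells. *)
Lemma poisson_average_range_below_mgf I s t :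
  poisson_average t (fun n => range_below_mgf I n s)
    (\prod_(i < I) (1 + occupancy t i * (expR s - 1))).
Proof.
under eq_fun do rewrite range_below_mgfE.
rewrite (eq_bigr (fun i : 'I_I =>
    expR s + (1 - expR s) * expR (- (t * mass p i)))); last first.
  by move=> i _; rewrite /occupancy; ring.
rewrite bigA_distr/=; apply: poisson_average_sum => J.
rewrite [X in poisson_average _ _ X](_ : _ =
    (\prod_i (if i \in J then expR s else 1 - expR s)) *
    expR (t * (1 - \sum_(i < I | i \in ~: J) mass p i - 1))).
  by apply: poisson_averageZ; exact: poisson_average_geometric.
rewrite [t * _](_ : _ = \sum_(i < I | i \in ~: J) - (t * mass p i)); last first.
  by rewrite sumrN -mulr_sumr; ring.
rewrite expR_sum [X in _ * X]big_mkcond -big_split/=; apply: eq_bigr => i _.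
by rewrite inE; case: (i \in J) => /=; rewrite ?mulr1.
Qed.

End RangeMgf.

(** * The mean occupancy function and bounds on the range *)

Section MeanOccupancy.
Set Implicit Arguments.
Unset Strict Implicit.
Unset Printing Implicit Defensive.
Context (R : realType).
Variable p : probability nat R.
Hypothesis hp : nonincreasing_positive_law p.
Implicit Types (n I : nat) (s t c : R).

Lemma mass_ge0 i : 0 <= mass p i.
Proof. exact: fine_ge0. Qed.

Lemma mass0 : mass p 0 = 0.
Proof. by rewrite /mass hp.1. Qed.

Lemma sum_mass_le1 I : \sum_(i < I) mass p i <= 1.
Proof.
rewrite -(fine_measure_ord p predT) -lee_fin fineK; last exact: fin_num_measure.
exact: probability_le1.
Qed.

Lemma occupancy0 t : occupancy p t 0 = 0.
Proof. by rewrite /occupancy mass0 mulr0 oppr0 expR0 subrr. Qed.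

Lemma occupancy_01 t i : 0 <= t -> 0 <= occupancy p t i <= 1.
Proof.
move=> t0; rewrite /occupancy subr_ge0 gerBl expR_ge0 andbT -[leRHS]expR0 ler_expR.
by rewrite oppr_le0 mulr_ge0// mass_ge0.
Qed.

Lemma occupancy_le t i : occupancy p t i <= t * mass p i.
Proof. by rewrite /occupancy; have := expR_ge1Dx (- (t * mass p i)); lra. Qed.

Lemma cvg_mean_occupancy t : 0 <= t ->
  \sum_(i < I) occupancy p t i @[I --> \oo] --> mean_occupancy p t.
Proof.
move=> t0; pose u I := \sum_(i < I) occupancy p t i.
have umono : nondecreasing_seq u.
  apply/nondecreasing_seqP => I; rewrite /u big_ord_recr/= lerDl.
  by have /andP[] := occupancy_01 I t0.
have ucvg : cvgn u.
  apply: nondecreasing_is_cvgn => //; exists t => _ [I _ <-].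
  apply: (@le_trans _ _ (\sum_(i < I) (t * mass p i))).
    by apply: ler_sum => i _; exact: occupancy_le.
  by rewrite -mulr_sumr ler_piMr// sum_mass_le1.
suff -> : mean_occupancy p t = limn u by [].
rewrite /mean_occupancy.
rewrite (_ : (fun n => _) = (EFin \o u)).
  by rewrite (EFin_lim ucvg).
apply/funext => I; rewrite /= /u -sumEFin -(big_mkord xpredT
  (fun i => (occupancy p t i)%:E)).
case: I => [|I]; first by rewrite !big_geq.
by rewrite [RHS]big_nat_recl//= occupancy0 add0e big_add1.
Qed.

Lemma mean_occupancy_ge0 t : 0 <= t -> 0 <= mean_occupancy p t.
Proof.
move=> t0; apply: cvgr_to_ge (cvg_mean_occupancy t0) _.
by apply: nearW => I; apply: sumr_ge0 => i _; have /andP[] := occupancy_01 i t0.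
Qed.

Lemma le_mean_occupancy s t : 0 <= s -> s <= t ->
  mean_occupancy p s <= mean_occupancy p t.
Proof.
move=> s0 st.
apply: ler_cvg_to (cvg_mean_occupancy s0) (cvg_mean_occupancy (le_trans s0 st)) _.
apply: nearW => I; apply: ler_sum => i _.
by rewrite /occupancy lerD2l lerN2 ler_expR lerN2 ler_wpM2r// mass_ge0.
Qed.

(** Concavity of mu with mu 0 = 0, the source of the bound on the change of mu
    under a relative perturbation of the time. *)
Lemma mean_occupancy_scale c t : 0 <= c <= 1 -> 0 <= t ->
  c * mean_occupancy p t <= mean_occupancy p (c * t).
Proof.
move=> c01 t0; have /andP[c0 _] := c01.
have h : c * \sum_(i < I) occupancy p t i @[I --> \oo] --> c * mean_occupancy p t.
  by apply: cvgM; [exact: cvg_cst|exact: cvg_mean_occupancy].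
apply: ler_cvg_to h (cvg_mean_occupancy (mulr_ge0 c0 t0)) _.
apply: nearW => I; rewrite mulr_sumr; apply: ler_sum => i _.
by rewrite /occupancy -mulrA; exact: one_minus_expRN_concave.
Qed.

Lemma mean_occupancy_perturb d t : `|d| <= 1 -> 0 <= t ->
  `|mean_occupancy p (t * (1 + d)) - mean_occupancy p t|
    <= `|d| * mean_occupancy p t.
Proof.
move=> d1 t0; have := mean_occupancy_ge0 t0; set m := mean_occupancy p t => m0.
have /andP[d1' d1''] : - 1 <= d <= 1 by rewrite -ler_norml.
have [d0|d0] := leP 0 d.
  have td : t <= t * (1 + d) by nra.
  have h := le_mean_occupancy t0 td.
  rewrite (ger0_norm d0) ger0_norm ?subr_ge0//.
  have c01 : 0 <= (1 + d)^-1 <= 1.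
    by rewrite invr_ge0 invf_le1; lra.
  have := mean_occupancy_scale c01 (le_trans t0 td).
  rewrite (_ : (1 + d)^-1 * (t * (1 + d)) = t); last by field; lra.
  rewrite -/m mulrC ler_pdivrMr; last by lra.
  lra.
have td : t * (1 + d) <= t by nra.
have h := le_mean_occupancy (mulr_ge0 t0 (_ : 0 <= 1 + d)) td.
rewrite (ltr0_norm d0) distrC ger0_norm; last by rewrite subr_ge0; apply: h; lra.
have := @mean_occupancy_scale (1 + d) t; rewrite mulrC -/m => k.
suff : m * (1 + d) <= mean_occupancy p (t * (1 + d)) by lra.
by rewrite [t * _]mulrC; apply: k => //; apply/andP; split; lra.
Qed.

Lemma cvg_sum_mass : \sum_(i < I) mass p i @[I --> \oo] --> (1 : R).
Proof.
have := @measure_semi_sigma_additive _ _ _ p (fun i : nat => [set i]).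
have -> : \bigcup_n [set n] = [set: nat].
  by apply/seteqP; split=> // x _; exists x.
move=> h.
have {}h : (\sum_(0 <= i < n) p [set i])%E @[n --> \oo] --> 1%E.
  rewrite -(@probability_setT _ _ _ p); apply: h => //.
  by move=> i j _ _ [k [/= -> ->]].
rewrite (_ : (fun _ => _) = (fun I => fine (\sum_(0 <= i < I) p [set i])%E)).
  exact: (fine_cvg h).
apply/funext => I /=.
rewrite big_mkord (eq_bigr (fun i : 'I_I => (mass p i)%:E)) ?sumEFin// => i _.
by rewrite /mass fineK//; exact: fin_num_measure.
Qed.

(** Cells of small index are at most finitely many; the others receive a small
    proportion of the sample. *)
Lemma mean_occupancy_le_split I t : 0 <= t ->
  mean_occupancy p t <= I%:R + t * (1 - \sum_(i < I) mass p i).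
Proof.
move=> t0; apply: cvgr_to_le (cvg_mean_occupancy t0) _.
near=> J.
have IJ : (I <= J)%N by near: J; exact: nbhs_infty_ge.
rewrite -(big_mkord xpredT (occupancy p t)) (big_cat_nat (n := I))//= lerD//.
  rewrite (@le_trans _ _ (\sum_(0 <= i < I) 1))//.
    by apply: ler_sum => i _; have /andP[] := occupancy_01 i t0.
  by rewrite sumr_const_nat subn0.
apply: (@le_trans _ _ (t * \sum_(I <= i < J) mass p i)).
  by rewrite mulr_sumr; apply: ler_sum => i _; exact: occupancy_le.
rewrite ler_wpM2l// lerBrDr.
have := sum_mass_le1 J; rewrite -(big_mkord xpredT (mass p)).
by rewrite (big_cat_nat (n := I))//= big_mkord addrC.
Unshelve. all: by end_near. Qed.

Lemma mean_occupancy_sublinear k : 0 < k ->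
  \forall n \near \oo, mean_occupancy p n%:R <= k * n%:R.
Proof.
move=> k0; have k20 : 0 < k / 2 by lra.
have /cvgrPdist_le/(_ _ k20)[I _ /(_ I (leqnn I))/=] := cvg_sum_mass.
move=> /(le_trans (ler_norm _)) hI.
near=> n.
apply: (le_trans (mean_occupancy_le_split I (ler0n R n))).
have h1 : I%:R <= k / 2 * n%:R.
  rewrite mulrC -ler_pdivrMr//; near: n; exact: nbhs_infty_ger.
have h2 : n%:R * (1 - \sum_(i < I) mass p i) <= n%:R * (k / 2) by rewrite ler_wpM2l.
lra.
Unshelve. all: by end_near. Qed.

(** The variance of a sum of independent Bernoulli variables with parameters
    q_i = 1 - exp (- t p_i), as q (1 - q) = exp (- t p_i) - exp (- 2 t p_i). *)
Definition occupancy_variance t : R :=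
  mean_occupancy p (2 * t) - mean_occupancy p t.

Lemma cvg_occupancy_variance t : 0 <= t ->
  \sum_(i < I) occupancy p t i * (1 - occupancy p t i) @[I --> \oo]
    --> occupancy_variance t.
Proof.
move=> t0; have t20 : 0 <= 2 * t by lra.
rewrite (_ : (fun _ => _) = (fun I =>
    \sum_(i < I) occupancy p (2 * t) i - \sum_(i < I) occupancy p t i)).
  by apply: cvgB; exact: cvg_mean_occupancy.
apply/funext => I; rewrite -sumrB; apply: eq_bigr => i _.
rewrite /occupancy (_ : - (2 * t * mass p i) = - (t * mass p i) + - (t * mass p i)).
  by rewrite expRD; ring.
by ring.
Qed.

(** The cumulant generating function at s of the number of cells occupied at a
    Poisson time of mean t, to second order; e = 1 and e = -1 add and subtract
    the error term. *)
Definition approx_cumulant s t e : R :=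
  s * mean_occupancy p t + s ^+ 2 / 2 * occupancy_variance t
    + e * (3 * `|s| ^+ 3) * mean_occupancy p t.

Lemma cvg_approx_cumulant s t e : 0 <= t ->
  \sum_(i < I) (occupancy p t i * s
    + occupancy p t i * (1 - occupancy p t i) * (s ^+ 2 / 2)
    + e * (occupancy p t i * (3 * `|s| ^+ 3))) @[I --> \oo]
    --> approx_cumulant s t e.
Proof.
move=> t0.
rewrite (_ : (fun _ => _) = (fun I => s * \sum_(i < I) occupancy p t i
    + s ^+ 2 / 2 * (\sum_(i < I) occupancy p t i * (1 - occupancy p t i))
    + e * (3 * `|s| ^+ 3) * \sum_(i < I) occupancy p t i)).
  by apply: cvgD; [apply: cvgD|]; apply: cvgM; do ?[exact: cvg_cst
    |exact: cvg_mean_occupancy|exact: cvg_occupancy_variance].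
apply/funext => I; rewrite !mulr_sumr -!big_split/=; apply: eq_bigr => i _.
by ring.
Qed.

Lemma cvg_expR_approx_cumulant s t e : 0 <= t ->
  expR (\sum_(i < I) (occupancy p t i * s
    + occupancy p t i * (1 - occupancy p t i) * (s ^+ 2 / 2)
    + e * (occupancy p t i * (3 * `|s| ^+ 3)))) @[I --> \oo]
    --> expR (approx_cumulant s t e).
Proof.
move=> t0; apply: continuous_cvg; first exact: continuous_expR.
exact: cvg_approx_cumulant.
Qed.

End MeanOccupancy.

Section RangeMgfBounds.
Set Implicit Arguments.
Unset Strict Implicit.
Unset Printing Implicit Defensive.
Context (R : realType) (d : measure_display) (T : measurableType d).
Variables (P : probability T R) (p : probability nat R).
Variable xi : nat -> {RV P >-> nat}.
Hypothesis hp : nonincreasing_positive_law p.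
Hypothesis hxi : iid_with_law p xi.
Implicit Types (n I : nat) (s t eta A : R).

(** For s > 0 the mean of exp (s R_n) increases with n, for s < 0 it decreases;
    eta has the sign of s in order to treat both cases at once. *)
Lemma range_mgf_upper n s t eta : 0 <= t -> `|s| <= 10^-1 ->
  0 <= s * eta -> eta != 0 ->
  range_mgf xi n s * (1 - expR (eta * n%:R + t * (expR (- eta) - 1)))
    <= expR (approx_cumulant p s t 1).
Proof.
move=> t0 s1 seta eta0.
set x := 1 - _.
have h : range_below_mgf xi I n s * x @[I --> \oo] --> range_mgf xi n s * x.
  by apply: cvgM; [exact: range_below_mgf_cvg|exact: cvg_cst].
apply: ler_cvg_to h (cvg_expR_approx_cumulant hp t0) _; apply: nearW => I.
apply: le_trans.
  apply: (@depoissonization_upper _ t (fun m => range_below_mgf xi I m s)) => //.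
  - by move=> m; exact: range_below_mgf_ge0.
  - move=> m mn; apply: range_below_mgf_mono.
    (* transfer the sign from eta (m - n) to s (m - n) *)
    have e2 : 0 < eta ^+ 2 by rewrite exprn_even_gt0.
    rewrite -(pmulr_rge0 _ e2).
    rewrite [leRHS](_ : _ = (s * eta) * (eta * (m%:R - n%:R))); last by ring.
    exact: mulr_ge0.
  - exact: (poisson_average_range_below_mgf hxi).
rewrite expR_sum; apply: ler_prod => i _.
have q01 := occupancy_01 p i t0.
have [l u] := bernoulli_mgf_bounds q01 s1.
by rewrite (le_trans _ l) ?expR_ge0//= mul1r.
Qed.

Lemma range_mgf_lower n s t eta A : 0 <= t -> `|s| <= 20^-1 ->
  0 <= s * eta -> eta != 0 -> 0 < A ->
  expR (approx_cumulant p s t (-1)) <= range_mgf xi n s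
    + A / 2 * expR (- (eta * n%:R) + t * (expR eta - 1))
    + expR (approx_cumulant p (2 * s) t 1) / (2 * A).
Proof.
move=> t0 s1 seta eta0 A0.
have s1' : `|s| <= 10^-1 by lra.
have s2 : `|2 * s| <= 10^-1 by rewrite normrM ger0_norm//; lra.
set x := A / 2 * _.
have h : range_below_mgf xi I n s + x + expR (\sum_(i < I) (occupancy p t i * (2 * s)
    + occupancy p t i * (1 - occupancy p t i) * ((2 * s) ^+ 2 / 2)
    + 1 * (occupancy p t i * (3 * `|2 * s| ^+ 3)))) / (2 * A) @[I --> \oo] -->
    range_mgf xi n s + x + expR (approx_cumulant p (2 * s) t 1) / (2 * A).
  apply: cvgD; last by apply: cvgM; [exact: cvg_expR_approx_cumulant|exact: cvg_cst].
  by apply: cvgD; [exact: range_below_mgf_cvg|exact: cvg_cst].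
apply: ler_cvg_to (cvg_expR_approx_cumulant hp t0) h _; apply: nearW => I.
rewrite expR_sum; apply: (@le_trans _ _
    (\prod_(i < I) (1 + occupancy p t i * (expR s - 1)))).
  apply: ler_prod => i _; rewrite expR_ge0/= mulN1r.
  by have [] := bernoulli_mgf_bounds (occupancy_01 p i t0) s1'.
apply: le_trans.
  apply: (@depoissonization_lower _ t (fun m => range_below_mgf xi I m s)
    (fun m => range_below_mgf xi I m (2 * s)) _ _ n eta A) => //.
  - by move=> m; exact: range_below_mgf_ge0.
  - by move=> m; exact: range_below_mgf_sqr.
  - move=> m mn; apply: range_below_mgf_mono.
    (* transfer the sign from eta (m - n) to s (m - n) *)
    have e2 : 0 < eta ^+ 2 by rewrite exprn_even_gt0.
    rewrite -(pmulr_rge0 _ e2).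
    rewrite [leRHS](_ : _ = (s * eta) * - (eta * (m%:R - n%:R))); last by ring.
    by rewrite mulr_ge0// oppr_ge0.
  - exact: (poisson_average_range_below_mgf hxi).
  - exact: (poisson_average_range_below_mgf hxi).
rewrite lerD2l ler_wpM2r//; first by rewrite invr_ge0; lra.
rewrite expR_sum; apply: ler_prod => i _.
have [l u] := bernoulli_mgf_bounds (occupancy_01 p i t0) s2.
by rewrite (le_trans _ l) ?expR_ge0//= mul1r.
Qed.

End RangeMgfBounds.

(** * Asymptotics of the moment generating functions *)

Section MomentGeneratingAsymptotics.
Set Implicit Arguments.
Unset Strict Implicit.
Unset Printing Implicit Defensive.
Context (R : realType).

Lemma expR1_ge2 (x : R) : 1 <= x -> 2 <= expR x.
Proof. by have := expR_ge1Dx x; lra. Qed.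

(** The three sources of error in the cumulant at a perturbed time: the shift of
    the mean (m' - m), of the variance (V - sig m), and the third-order term. Here
    be = sqrt (b / m), al = sqrt (m / n), and D is the relative time shift, chosen
    such that n D^2 = K^2 b; every error is then b times a factor that vanishes
    with al and be. *)
Lemma cumulant_error (la K al be m b m' D V sig k e : R) :
  0 <= be -> 0 <= m -> b = be ^+ 2 * m ->
  D = K * al * be -> 0 <= D <= 1 ->
  `|m' - m| <= D * m -> `|V - sig * m| <= (3 * D + k) * m -> `|e| <= 1 ->
  `|(la * be) * m' + (la * be) ^+ 2 / 2 * V + e * (3 * `|la * be| ^+ 3) * m'
     - (la * be * m + la ^+ 2 / 2 * sig * b)|
  <= (`|la| * K * al + 6 * `|la| ^+ 3 * be + la ^+ 2 / 2 * (3 * D + k)) * b.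
Proof.
move=> be0 m0 bE DE /andP[D0 D1] m'm Vm e1.
have -> : (la * be) * m' + (la * be) ^+ 2 / 2 * V + e * (3 * `|la * be| ^+ 3) * m'
     - (la * be * m + la ^+ 2 / 2 * sig * b) =
  la * be * (m' - m) + (la * be) ^+ 2 / 2 * (V - sig * m)
    + e * (3 * `|la * be| ^+ 3) * m' by rewrite bE; ring.
have -> : (`|la| * K * al + 6 * `|la| ^+ 3 * be + la ^+ 2 / 2 * (3 * D + k)) * b =
  `|la| * be * (D * m) + (la * be) ^+ 2 / 2 * ((3 * D + k) * m)
    + 1 * (3 * (`|la| * be) ^+ 3) * (2 * m) by rewrite bE DE; ring.
have m'2 : `|m'| <= 2 * m.
  have := ler_normD (m' - m) m; rewrite subrK (ger0_norm m0) => /le_trans; apply.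
  nra.
rewrite (le_trans (ler_normD _ _))// lerD//.
  rewrite (le_trans (ler_normD _ _))// lerD//.
    rewrite !normrM (ger0_norm be0) ler_wpM2l//.
    by rewrite mulr_ge0.
  rewrite normrM ger0_norm; last by rewrite divr_ge0// sqr_ge0.
  by rewrite ler_wpM2l// divr_ge0// sqr_ge0.
rewrite 2!normrM (normrM 3) normrX normr_id (normrM la) (ger0_norm be0).
rewrite [`|3|]ger0_norm//.
have l0 : 0 <= 3 * (`|la| * be) ^+ 3 by rewrite mulr_ge0// exprn_ge0// mulr_ge0.
rewrite ler_pM//; first exact: mulr_ge0.
by rewrite ler_wpM2r.
Qed.

Context (d : measure_display) (T : measurableType d).
Variables (P : probability T R) (p : probability nat R).
Variable xi : nat -> {RV P >-> nat}.
Variables (b : nat -> R) (sig : R).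
Hypothesis hp : nonincreasing_positive_law p.
Hypothesis hxi : iid_with_law p xi.
Hypothesis hb0 : forall n : nat, (1 <= n)%N -> 0 < b n.
Hypothesis hb : b n @[n --> \oo] --> +oo.
Hypothesis hmub : mean_occupancy p n%:R / b n @[n --> \oo] --> +oo.
Hypothesis hvar :
  occupancy_variance p n%:R / mean_occupancy p n%:R @[n --> \oo] --> sig.

(** The scale sqrt (b / mu): the exponent la * scale n of the moment generating
    function of R_n corresponds to the exponent la * b n for Z_n. *)
Definition mgf_scale n : R := Num.sqrt (b n / mean_occupancy p n%:R).

(** A relative time shift dl with n dl^2 = K^2 b makes Poisson tails of order
    exp (- K^2 b / 8), yet it moves the mean occupancy by K sqrt (b / n) mu, which
    is negligible against sqrt (mu b) because mu (n) = o(n). *)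
Lemma approx_cumulant_near la K eps : 0 <= K -> 0 < eps ->
  \forall n \near \oo, 0 < mean_occupancy p n%:R /\ `|la * mgf_scale n| <= 20^-1 /\
  forall dl e, dl ^+ 2 * n%:R = K ^+ 2 * b n -> `|e| <= 1 ->
  `|dl| <= 2^-1 /\
  `|approx_cumulant p (la * mgf_scale n) (n%:R * (1 + dl)) e
    - (la * mgf_scale n * mean_occupancy p n%:R + la ^+ 2 / 2 * sig * b n)|
    <= eps * b n.
Proof.
move=> K0 eps0.
(* k bounds al and be; C collects the coefficients of the error, the other terms
   of D ensure |dl| <= 1/2 and |s| <= 1/20 *)
pose C := `|la| * K + 6 * `|la| ^+ 3 + la ^+ 2 / 2 * (3 * K + 1).
pose D := 1 + C + 20 * `|la| + 2 * K.
pose k := Num.min eps 1 / D.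
have la0 := normr_ge0 la.
have la3 : 0 <= `|la| ^+ 3 by exact: exprn_ge0.
have la2 : 0 <= la ^+ 2 by exact: sqr_ge0.
have laK : 0 <= `|la| * K by exact: mulr_ge0.
have C0 : 0 <= C by rewrite /C; nra.
have D0 : 0 < D by rewrite /D; lra.
have k0 : 0 < k by rewrite divr_gt0// lt_min eps0 ltr01.
have kE : k * D = Num.min eps 1 by rewrite /k divfK// gt_eqF.
have m1 : Num.min eps 1 <= 1 by rewrite ge_min lexx orbT.
have m2 : Num.min eps 1 <= eps by rewrite ge_min lexx.
have kC0 : 0 <= k * C by nra.
have kl0 : 0 <= k * `|la| by nra.
have kK0 : 0 <= k * K by nra.
have kD : k * D = k + k * C + 20 * (k * `|la|) + 2 * (k * K) by rewrite /D; ring.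
have k1 : k <= 1 by lra.
have kC : k * C <= eps by lra.
have kla : k * `|la| <= 20^-1 by lra.
have kK : k * K <= 2^-1 by lra.
have k20 : 0 < k ^+ 2 by exact: exprn_gt0.
have nb : \forall n \near \oo, (k ^+ 2)^-1 <= mean_occupancy p n%:R / b n.
  by have /cvgryPge := hmub; apply.
have nv : \forall n \near \oo,
    `|sig - occupancy_variance p n%:R / mean_occupancy p n%:R| <= k.
  by have /cvgrPdist_le := hvar; apply.
near=> n.
have n0 : (1 <= n)%N by near: n; exact: nbhs_infty_gt.
have n0R : 0 < n%:R :> R by rewrite ltr0n.
have bn0 := hb0 n0.
have nvn : `|sig - occupancy_variance p n%:R / mean_occupancy p n%:R| <= k.
  by near: n; exact: nv.
have bm : b n <= k ^+ 2 * mean_occupancy p n%:R.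
  rewrite -ler_pdivrMl// -ler_pdivlMr//; near: n; exact: nb.
have mn : mean_occupancy p n%:R <= k ^+ 2 * n%:R.
  by near: n; exact: mean_occupancy_sublinear.
set m := mean_occupancy p n%:R in nvn bm mn *.
have m0 : 0 < m by rewrite -(pmulr_rgt0 _ k20); apply: lt_le_trans bm.
have Vm : `|occupancy_variance p n%:R - sig * m| <= k * m.
  move: nvn; rewrite -(ler_pM2r m0) -{2}(gtr0_norm m0) -normrM mulrBl divfK ?gt_eqF//.
  by rewrite distrC.
pose be := mgf_scale n; pose al := Num.sqrt (m / n%:R).
have be0 : 0 <= be by exact: sqrtr_ge0.
have al0 : 0 <= al by exact: sqrtr_ge0.
have be2 : be ^+ 2 = b n / m by rewrite sqr_sqrtr// divr_ge0// ltW.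
have al2 : al ^+ 2 = m / n%:R by rewrite sqr_sqrtr// divr_ge0// ltW.
have bE : b n = be ^+ 2 * m by rewrite be2 divfK// gt_eqF.
have bek : be <= k.
  by rewrite -(@ler_pXn2r _ 2)// ?nnegrE ?(ltW k0)// be2 ler_pdivrMr.
have alk : al <= k.
  by rewrite -(@ler_pXn2r _ 2)// ?nnegrE ?(ltW k0)// al2 ler_pdivrMr.
split=> //; split.
  by rewrite normrM (ger0_norm be0) (le_trans _ kla)// mulrC ler_wpM2r.
move=> dl e dlE e1.
have dlN : `|dl| = K * al * be.
  apply/eqP; rewrite -(@eqrXn2 _ 2)// ?mulr_ge0// real_normK ?num_real//.
  rewrite !exprMn be2 al2 -(inj_eq (mulIf (lt0r_neq0 n0R))) dlE; apply/eqP.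
  by field; rewrite !gt_eqF.
have dl2 : `|dl| <= 2^-1.
  rewrite dlN (le_trans _ kK)// -mulrA mulrC ler_wpM2r//.
  by rewrite -[leRHS]mulr1 ler_pM// (le_trans bek).
have dl1 : `|dl| <= 1 by lra.
split=> //.
have m' := mean_occupancy_perturb hp dl1 (ltW n0R).
have m'' := mean_occupancy_perturb hp dl1 (mulr_ge0 (ler0n R 2) (ltW n0R)).
have mm : mean_occupancy p (2 * n%:R) <= 2 * m.
  have := @mean_occupancy_scale _ p hp 2^-1 (2 * n%:R).
  rewrite mulKf// -/m => h.
  rewrite -ler_pdivrMl//; apply: h; last by rewrite mulr_ge0// ltW.
  by rewrite invr_ge0 ler0n invf_le1 ?ltr0n// ler1n.
have dl0 := normr_ge0 dl.
apply: le_trans.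
  apply: (@cumulant_error la K al be m (b n) _ `|dl| _ sig k e) => //.
  - exact: ltW.
  - by rewrite dl0.
  - rewrite /occupancy_variance.
    have -> : mean_occupancy p (2 * (n%:R * (1 + dl))) - mean_occupancy p (n%:R * (1 + dl)) - sig * m
      = (mean_occupancy p (2 * n%:R * (1 + dl)) - mean_occupancy p (2 * n%:R))
        - (mean_occupancy p (n%:R * (1 + dl)) - m)
        + (occupancy_variance p n%:R - sig * m).
      by rewrite /occupancy_variance -/m [2 * (_ * _)]mulrA; ring.
    rewrite [leRHS]mulrDl (le_trans (ler_normD _ _))// lerD//.
    rewrite (le_trans (ler_normB _ _))//.
    have -> : 3 * `|dl| * m = `|dl| * (2 * m) + `|dl| * m by ring.
    by rewrite lerD// (le_trans m'')// ler_wpM2l.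
rewrite ler_wpM2r ?(ltW bn0)// (le_trans _ kC)// /C.
have h1 : `|la| * K * al <= `|la| * K * k by rewrite ler_wpM2l.
have h2 : `|la| ^+ 3 * be <= `|la| ^+ 3 * k by rewrite ler_wpM2l.
have h3 : `|dl| <= K * k.
  by rewrite dlN -mulrA ler_wpM2l// -[leRHS]mulr1 ler_pM// (le_trans bek).
have h4 : la ^+ 2 / 2 * (3 * `|dl| + k) <= la ^+ 2 / 2 * (3 * (K * k) + k).
  by rewrite ler_wpM2l ?divr_ge0// lerD2r ler_wpM2l.
by clear -h1 h2 h4; lra.
Unshelve. all: by end_near. Qed.

(** Poissonization at the time n (1 + dl), where the window n dl^2 = 16 b gives a
    Poisson tail at most exp (- 2 b), eventually at most 1/2. *)
Lemma mgf_near_upper la eps : 0 < eps ->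
  \forall n \near \oo, range_mgf xi n (la * mgf_scale n)
    <= expR (la * mgf_scale n * mean_occupancy p n%:R
             + (la ^+ 2 / 2 * sig + eps) * b n).
Proof.
move=> eps0; have e20 : 0 < eps / 2 by lra.
have K0 : 0 <= 4 :> R by [].
near=> n.
have n0 : (1 <= n)%N by near: n; exact: nbhs_infty_gt.
have n0R : 0 < n%:R :> R by rewrite ltr0n.
have bn0 := hb0 n0.
have [m0 [s20 H]] : 0 < mean_occupancy p n%:R /\ `|la * mgf_scale n| <= 20^-1 /\
  forall dl e, dl ^+ 2 * n%:R = 4 ^+ 2 * b n -> `|e| <= 1 ->
  `|dl| <= 2^-1 /\
  `|approx_cumulant p (la * mgf_scale n) (n%:R * (1 + dl)) e
    - (la * mgf_scale n * mean_occupancy p n%:R + la ^+ 2 / 2 * sig * b n)|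
    <= eps / 2 * b n.
  by near: n; exact: approx_cumulant_near.
have b1 : 1 <= b n by near: n; move/cvgryPge : hb; exact.
have b2 : 2 / eps <= b n by near: n; move/cvgryPge : hb; exact.
have b2e : 1 <= eps / 2 * b n.
  rewrite -ler_pdivrMl// mulr1; apply: le_trans b2.
  by rewrite invf_div.
set s := la * mgf_scale n in s20 H *.
(* the time is shifted towards larger values of the moment generating function *)
pose sg : R := if 0 <= s then 1 else -1.
have sg2 : sg ^+ 2 = 1 by rewrite /sg; case: ifP => _; rewrite ?sqrrN expr1n.
have ssg : 0 <= s * sg.
  rewrite /sg; case: ifPn; rewrite ?mulr1// -ltNge => /ltW.
  by rewrite mulrN1 oppr_ge0.
pose dl := sg * Num.sqrt (16 * b n / n%:R).
have q0 : 0 < 16 * b n / n%:R by rewrite divr_gt0// mulr_gt0.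
have dlE : dl ^+ 2 * n%:R = 4 ^+ 2 * b n.
  rewrite exprMn sg2 mul1r sqr_sqrtr ?(ltW q0)// divfK ?gt_eqF//.
  by rewrite -natrX.
have one1 : `|1 : R| <= 1 by rewrite normr1.
have [dl2 {}H] := H dl 1 dlE one1.
have dl0 : dl / 2 != 0.
  rewrite mulf_neq0 ?invr_neq0// /dl mulf_neq0//.
    by rewrite -sqrf_eq0 sg2 oner_neq0.
  by rewrite gt_eqF// sqrtr_gt0.
have t0 : 0 <= n%:R * (1 + dl).
  rewrite mulr_ge0//; move: dl2; rewrite ler_norml; lra.
have s10 : `|s| <= 10^-1 by lra.
have sdl : 0 <= s * (dl / 2).
  by rewrite mulrA divr_ge0// /dl mulrA mulr_ge0// sqrtr_ge0.
have := range_mgf_upper hp hxi n t0 s10 sdl dl0.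
have -> : dl / 2 * n%:R + n%:R * (1 + dl) * (expR (- (dl / 2)) - 1) =
  n%:R * (dl / 2 + (1 + dl) * (expR (- (dl / 2)) - 1)) by ring.
have := poisson_chernoff_exponent dl2.
move=> /(ler_wpM2l (ltW n0R)); set E := n%:R * (dl / 2 + _) => hE.
have {}hE : E <= - (2 * b n) by move: hE; lra.
have hE2 : expR E <= 2^-1.
  apply: (@le_trans _ _ (expR (- (2 * b n)))); first by rewrite ler_expR.
  by rewrite expRN lef_pV2 ?posrE ?expR_gt0// expR1_ge2//; lra.
move=> hU; have mg0 : 0 <= range_mgf xi n s.
  by apply: Rintegral_ge0 => w _; exact: expR_ge0.
apply: (@le_trans _ _ (2 * expR (approx_cumulant p s (n%:R * (1 + dl)) 1))).
  nra.
apply: (@le_trans _ _ (expR (eps / 2 * b n) *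
    expR (approx_cumulant p s (n%:R * (1 + dl)) 1))).
  by rewrite ler_wpM2r ?expR_ge0// expR1_ge2.
rewrite -expRD ler_expR; move: H; rewrite ler_norml; lra.
Unshelve. all: by end_near. Qed.

Hypothesis sig0 : 0 <= sig.

(** Poissonization on the other side of n. With A = exp (s mu + L b), the second
    moment divided by A is at most exp (s mu - b) as L exceeds the quadratic rate
    at 2 la by 2, and the window K^2 = 8 (L + 2) makes A times the Poisson tail
    at least as small. *)
Lemma mgf_near_lower la eps : 0 < eps -> eps <= 1 ->
  \forall n \near \oo, expR (la * mgf_scale n * mean_occupancy p n%:R
             + (la ^+ 2 / 2 * sig - eps) * b n) <=
    range_mgf xi n (la * mgf_scale n).
Proof.
move=> eps0 eps1; have e20 : 0 < eps / 2 by lra.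
pose L := 2 * la ^+ 2 * sig + 2.
have la2 : 0 <= la ^+ 2 * sig by rewrite mulr_ge0// sqr_ge0.
pose K := Num.sqrt (8 * (L + 2)).
have K2 : K ^+ 2 = 8 * (L + 2) by rewrite sqr_sqrtr// /L; lra.
have K0 : 0 <= K by exact: sqrtr_ge0.
near=> n.
have n0 : (1 <= n)%N by near: n; exact: nbhs_infty_gt.
have n0R : 0 < n%:R :> R by rewrite ltr0n.
have bn0 := hb0 n0.
have [m0 [s20 H1]] : 0 < mean_occupancy p n%:R /\ `|la * mgf_scale n| <= 20^-1 /\
  forall dl e, dl ^+ 2 * n%:R = K ^+ 2 * b n -> `|e| <= 1 ->
  `|dl| <= 2^-1 /\
  `|approx_cumulant p (la * mgf_scale n) (n%:R * (1 + dl)) e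
    - (la * mgf_scale n * mean_occupancy p n%:R + la ^+ 2 / 2 * sig * b n)|
    <= eps / 2 * b n.
  by near: n; exact: approx_cumulant_near.
have [_ [_ H2]] : 0 < mean_occupancy p n%:R /\ `|(2 * la) * mgf_scale n| <= 20^-1 /\
  forall dl e, dl ^+ 2 * n%:R = K ^+ 2 * b n -> `|e| <= 1 ->
  `|dl| <= 2^-1 /\
  `|approx_cumulant p ((2 * la) * mgf_scale n) (n%:R * (1 + dl)) e
    - ((2 * la) * mgf_scale n * mean_occupancy p n%:R + (2 * la) ^+ 2 / 2 * sig * b n)|
    <= 1 * b n.
  by near: n; exact: approx_cumulant_near.
have b1 : 2 <= b n by near: n; move/cvgryPge : hb; exact.
have b2 : 2 / eps <= b n by near: n; move/cvgryPge : hb; exact.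
have b2e : 1 <= eps / 2 * b n.
  rewrite -ler_pdivrMl// mulr1; apply: le_trans b2.
  by rewrite invf_div.
rewrite -mulrA in H2.
set s := la * mgf_scale n in s20 H1 H2 *.
set m := mean_occupancy p n%:R in m0 H1 H2 *.
(* the time is shifted towards smaller values of the moment generating function *)
pose sg : R := if 0 <= s then 1 else -1.
have sg2 : sg ^+ 2 = 1 by rewrite /sg; case: ifP => _; rewrite ?sqrrN expr1n.
have ssg : 0 <= s * sg.
  rewrite /sg; case: ifPn; rewrite ?mulr1// -ltNge => /ltW.
  by rewrite mulrN1 oppr_ge0.
pose dl := - (sg * Num.sqrt (K ^+ 2 * b n / n%:R)).
have q0 : 0 < K ^+ 2 * b n / n%:R.
  by rewrite divr_gt0// mulr_gt0// K2 /L; lra.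
have dlE : dl ^+ 2 * n%:R = K ^+ 2 * b n.
  by rewrite sqrrN exprMn sg2 mul1r sqr_sqrtr ?(ltW q0)// divfK ?gt_eqF.
have one1 : `|1 : R| <= 1 by rewrite normr1.
have one1' : `|-1 : R| <= 1 by rewrite normrN1.
have [dl2 {}H1] := H1 dl (-1) dlE one1'.
have [_ {}H2] := H2 dl 1 dlE one1.
have dl0 : - dl / 2 != 0.
  rewrite mulf_neq0 ?invr_neq0// /dl opprK mulf_neq0//.
    by rewrite -sqrf_eq0 sg2 oner_neq0.
  by rewrite gt_eqF// sqrtr_gt0.
have t0 : 0 <= n%:R * (1 + dl).
  rewrite mulr_ge0//; move: dl2; rewrite ler_norml; lra.
have sdl : 0 <= s * (- dl / 2).
  by rewrite mulrA divr_ge0// /dl opprK mulrA mulr_ge0// sqrtr_ge0.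
pose A := expR (s * m + L * b n).
have := range_mgf_lower hp hxi n t0 s20 sdl dl0 (expR_gt0 (s * m + L * b n)).
rewrite -/A.
have -> : - (- dl / 2 * n%:R) + n%:R * (1 + dl) * (expR (- dl / 2) - 1) =
  n%:R * (dl / 2 + (1 + dl) * (expR (- (dl / 2)) - 1)) by rewrite mulNr; ring.
have := poisson_chernoff_exponent dl2.
move=> /(ler_wpM2l (ltW n0R)); set E := n%:R * (dl / 2 + _) => hE.
have {}hE : E <= - ((L + 2) * b n) by move: hE dlE; rewrite K2; lra.
set M := range_mgf xi n s => hM.
have tail1 : A / 2 * expR E <= 2^-1 * expR (s * m - b n).
  by rewrite mulrAC mulrC ler_wpM2l// /A -expRD ler_expR; lra.
have tail2 : expR (approx_cumulant p (2 * s) (n%:R * (1 + dl)) 1) / (2 * A)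
    <= 2^-1 * expR (s * m - b n).
  rewrite invfM mulrCA ler_wpM2l// /A -expRN -expRD ler_expR.
  by move: H2; rewrite ler_norml /L; lra.
pose X := s * m + (la ^+ 2 / 2 * sig - eps / 2) * b n.
have main : expR X <= M + expR (s * m - b n).
  apply: le_trans (_ : expR (approx_cumulant p s (n%:R * (1 + dl)) (-1)) <= _).
    by rewrite ler_expR /X; move: H1; rewrite ler_norml; lra.
  by apply: le_trans hM _; lra.
have half1 : 2 * expR (s * m - b n) <= expR X.
  apply: (@le_trans _ _ (expR (b n / 2) * expR (s * m - b n))).
    by rewrite ler_wpM2r ?expR_ge0// expR1_ge2//; lra.
  by rewrite -expRD ler_expR /X; nra.
have half2 : 2 * expR (s * m + (la ^+ 2 / 2 * sig - eps) * b n) <= expR X.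
  apply: (@le_trans _ _ (expR (eps / 2 * b n) *
      expR (s * m + (la ^+ 2 / 2 * sig - eps) * b n))).
    by rewrite ler_wpM2r ?expR_ge0// expR1_ge2.
  by rewrite -expRD ler_expR /X; lra.
by lra.
Unshelve. all: by end_near. Qed.

End MomentGeneratingAsymptotics.

(** * Regular variation *)

Section SeriesOfMeasures.
Set Implicit Arguments.
Unset Strict Implicit.
Unset Printing Implicit Defensive.

(** Integrating the pointwise comparison, as a sum of measures of sets is the
    integral of the function counting the sets that contain a point. *)
Lemma nneseries_measure_le (R : realType) d (T : measurableType d) (Q : probability T R)
    (A B : nat -> set T) (k C : R) :
  (forall i, measurable (A i)) -> (forall i, measurable (B i)) ->
  0 <= k -> 0 <= C ->
  (forall y, (\sum_(0 <= i <oo) (\1_(A i) y : R)%:E <=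
    k%:E * (\sum_(0 <= i <oo) (\1_(B i) y : R)%:E) + C%:E)%E) ->
  (\sum_(0 <= i <oo) Q (A i) <= k%:E * (\sum_(0 <= i <oo) Q (B i)) + C%:E)%E.
Proof.
move=> mA mB k0 C0 AB.
have sumE (D : nat -> set T) : (forall i, measurable (D i)) ->
    (\sum_(0 <= i <oo) Q (D i) = \int[Q]_y \sum_(0 <= i <oo) (\1_(D i) y : R)%:E)%E.
  move=> mD; rewrite integral_nneseries//.
  - by apply: eq_eseriesr => i _; rewrite integral_indic// setIT.
  - by move=> i; apply/measurable_EFinP; exact: measurable_indic.
have mS (D : nat -> set T) : (forall i, measurable (D i)) ->
    measurable_fun setT (fun y => \sum_(0 <= i <oo) (\1_(D i) y : R)%:E)%E.
  move=> mD; apply: ge0_emeasurable_sum => // i _.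
  by apply/measurable_EFinP; exact: measurable_indic.
have S0 (D : nat -> set T) y : (0 <= \sum_(0 <= i <oo) (\1_(D i) y : R)%:E)%E.
  by apply: nneseries_ge0 => i _ _; rewrite lee_fin.
rewrite !sumE//.
apply: (@le_trans _ _ (\int[Q]_y
    (k%:E * (\sum_(0 <= i <oo) (\1_(B i) y : R)%:E) + C%:E))%E).
  apply: ge0_le_integral => //; first exact: mS.
  by apply: emeasurable_funD => //; apply: measurable_funeM; exact: mS.
rewrite ge0_integralD//; last 2 first.
- by move=> y _; rewrite mule_ge0.
- by apply: measurable_funeM; exact: mS.
rewrite ge0_integralZl_EFin//; last exact: mS.
rewrite leeD2l// integral_cst//.
rewrite -[leRHS]mule1; apply: lee_wpmul2l; first by rewrite lee_fin.
exact: probability_le1.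
Qed.

End SeriesOfMeasures.

Section RegularVariation.
Set Implicit Arguments.
Unset Strict Implicit.
Unset Printing Implicit Defensive.
Context (R : realType).
Variables (p : probability nat R) (gamma : R) (zeta : R -> R).
Hypothesis hp : nonincreasing_positive_law p.
Hypothesis hgamma : 0 < gamma < 1.
Hypothesis hzeta : regular_function gamma zeta.
Hypothesis hinv : mass p n * increasing_inverse zeta n%:R @[n --> \oo] --> (1 : R).
Implicit Types (x y a eta : R) (m n i : nat).

Let zeta_lt x y : 0 <= x -> x < y -> zeta x < zeta y.
Proof. by case: hzeta => _ h _; exact: h. Qed.

Lemma zeta_le x y : 0 <= x -> x <= y -> zeta x <= zeta y.
Proof.
by move=> x0; rewrite le_eqVlt => /predU1P[->//|xy]; rewrite ltW// zeta_lt.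
Qed.

(** A bounded zeta would have inf of the empty set, that is 0, as its
    generalized inverse at all large integers. *)
Lemma zeta_unbounded M : exists2 x, 0 <= x & M <= zeta x.
Proof.
have h2 : 0 < 2^-1 :> R by rewrite invr_gt0.
have /cvgrPdist_le/(_ _ h2)[N _ HN] := hinv.
pose n := maxn N (Num.trunc M).+1.
have /= := HN n (leq_maxl _ _).
case: (eqVneq [set x | 0 <= x /\ n%:R <= zeta x] set0) => [S0|].
  by rewrite /increasing_inverse S0 inf0 mulr0 subr0 normr1; lra.
move=> /set0P[x [x0 nx]] _; exists x => //; apply: le_trans nx.
apply: ltW; apply: lt_le_trans (truncnS_gt M) _.
by rewrite ler_nat leq_maxr.
Qed.

Lemma zeta_near M : \forall x \near +oo, M <= zeta x.
Proof.
have [x0 x00 Mx0] := zeta_unbounded M.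
near=> x; have x0x : x0 <= x by near: x; apply: nbhs_pinfty_ge; exact: num_real.
by apply: (le_trans Mx0); exact: zeta_le.
Unshelve. all: by end_near. Qed.

(** As the masses are nonincreasing, the indices i >= 1 with p_i >= a form the
    initial segment 1, ..., m. *)
Definition is_count a m : Prop := forall i, (a <= mass p i.+1) = (i < m)%N.

Lemma mass_nonincreasing : {homo (fun i => mass p i.+1) : i j / (i <= j)%N >-> j <= i}.
Proof.
apply: homo_leq; [by []|by move=> x y z; exact: ge_trans|].
by move=> i; exact: (hp.2 i.+1 isT).2.
Qed.

Lemma mass_lt_eventually a : 0 < a -> exists i, mass p i.+1 < a.
Proof.
move=> a0; pose N := (Num.trunc a^-1).+1.
exists N; rewrite ltNge; apply/negP => aN.
have : \sum_(i < N) mass p i.+1 <= 1.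
  have := sum_mass_le1 p N.+1; rewrite big_ord_recl; apply: le_trans.
  by rewrite lerDr mass_ge0.
have : \sum_(i < N) a <= \sum_(i < N) mass p i.+1.
  apply: ler_sum => i _; apply: (le_trans aN).
  by apply: mass_nonincreasing; exact: ltnW.
rewrite sumr_const card_ord -mulr_natr => h1 h2.
have := truncnS_gt a^-1; rewrite -/N -(ltr_pM2l a0) divff ?gt_eqF//.
lra.
Qed.

Lemma is_count_exists a : 0 < a -> exists m, is_count a m.
Proof.
move=> a0; pose Q i := mass p i.+1 < a.
have exQ : exists i, Q i by exact: mass_lt_eventually.
exists (ex_minn exQ) => i; case: ex_minnP => m Qm mmin.
apply/idP/idP => [ai|im].
  rewrite ltnNge; apply/negP => mi.
  by have := le_lt_trans (le_trans ai (mass_nonincreasing mi)) Qm; rewrite ltxx.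
rewrite leNgt; apply/negP => /mmin; by rewrite leqNgt im.
Qed.

Lemma is_count_le a a' m m' : a' <= a -> is_count a m -> is_count a' m' ->
  (m <= m')%N.
Proof.
move=> aa' cm cm'; case: m cm => [//|m] cm.
by rewrite -cm' (le_trans aa')// cm.
Qed.

(** The counting function is the inverse of i |-> p_i up to a shift by one, as
    zeta is of its generalized inverse. *)
Lemma count_bounds eta : 0 < eta -> eta < 1 ->
  \forall x \near +oo, forall m, is_count x^-1 m ->
    zeta ((1 - eta) * x) - 1 <= m%:R /\ m%:R <= zeta ((1 + 2 * eta) * x).
Proof.
move=> eta0 eta1.
have /cvgrPdist_le/(_ _ eta0)[N _ HN] := hinv.
have [y0 y00 Ny0] := zeta_unbounded N.+1%:R.
have e1 : 0 < 1 - eta by lra.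
near=> x.
have x0 : 0 < x by near: x; exact: nbhs_pinfty_gt.
have xy0 : y0 <= (1 - eta) * x.
  rewrite -ler_pdivrMl//; near: x; exact: nbhs_pinfty_ge.
have zN : N.+1%:R <= zeta ((1 - eta) * x) by apply: (le_trans Ny0); exact: zeta_le.
have ex0 : 0 <= (1 - eta) * x by rewrite mulr_ge0// ltW.
move=> m cm; split.
  set z := zeta _ in zN *.
  have z0 : 0 <= z by exact: le_trans zN.
  have /andP[jz zj] := truncn_itv z0; set j := Num.trunc z in jz zj.
  have Nj : (N < j.+1)%N by rewrite -(ltr_nat R); apply: le_lt_trans zj; apply: le_trans zN; rewrite ler_nat.
  have j0 : (0 < j)%N.
    by rewrite -ltnS -(ltr_nat R); apply: le_lt_trans zj; apply: le_trans zN; rewrite ler_nat.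
  have /= := HN j Nj; rewrite ler_norml => /andP[_ Hj].
  have invj : increasing_inverse zeta j%:R <= (1 - eta) * x.
    by apply: ge_inf; [exists 0 => y []|split].
  have mj : x^-1 <= mass p j.
    rewrite -(ler_pM2r x0) mulVf ?gt_eqF//.
    have := ler_wpM2l (mass_ge0 p j) invj; nra.
  have : (j.-1 < m)%N by rewrite -cm prednK.
  rewrite prednK// -(ler_nat R) => jm.
  by rewrite lerBlDr ltW// (lt_le_trans zj)// -natr1 lerD2r.
rewrite leNgt; apply/negP => zm.
have x2 : (1 - eta) * x <= (1 + 2 * eta) * x by rewrite ler_pM2r//; lra.
have Nm : (N < m)%N.
  rewrite -(ltr_nat R); apply: le_lt_trans zm.
  apply: le_trans (zeta_le ex0 x2); apply: le_trans zN.
  by rewrite ler_nat.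
have m0 : (0 < m)%N by exact: leq_ltn_trans Nm.
have xm : x^-1 <= mass p m.
  have -> : mass p m = mass p m.-1.+1 by rewrite prednK.
  by rewrite cm prednK.
have invm : (1 + 2 * eta) * x <= increasing_inverse zeta m%:R.
  apply: lb_le_inf; first by have [y ? ?] := zeta_unbounded m%:R; exists y.
  move=> y [y0' my]; rewrite leNgt; apply/negP => yx.
  by have := lt_trans (zeta_lt y0' yx) zm; rewrite ltNge my.
have /= := HN m (ltnW Nm); rewrite ler_norml => /andP[Hm _].
have xi0 : 0 < x^-1 by rewrite invr_gt0.
have x20 : 0 <= (1 + 2 * eta) * x by rewrite mulr_ge0 ?(ltW x0)//; lra.
have := ler_pM (ltW xi0) x20 xm invm.
rewrite mulrCA mulVf ?gt_eqF// mulr1; lra.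
Unshelve. all: by end_near. Qed.

(** As gamma is in (0, 1), (1 - eta)^gamma >= 1 - eta and
    (1 + 2 eta)^gamma <= 1 + 2 eta; the remaining slack absorbs the passage to the
    limit and the shift by one. *)
Lemma count_asymptotics eta : 0 < eta -> eta < 1 ->
  \forall x \near +oo, forall m, is_count x^-1 m ->
    (1 - 2 * eta) * zeta x <= m%:R /\ m%:R <= (1 + 3 * eta) * zeta x.
Proof.
move=> eta0 eta1; have /andP[g0 g1] := hgamma.
have [_ _ hz] := hzeta.
have e1 : 0 < 1 - eta by lra.
have e2 : 0 < 1 + 2 * eta by lra.
have p1 : 1 - eta <= (1 - eta) `^ gamma by apply: ger1_powR; [apply/andP; split; lra|lra].
have p2 : (1 + 2 * eta) `^ gamma <= 1 + 2 * eta by apply: ler1_powR; lra.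
have h1 : 1 - 3 / 2 * eta < (1 - eta) `^ gamma by lra.
have h2 : (1 + 2 * eta) `^ gamma < 1 + 3 * eta by lra.
have n1 := cvgr_ge _ (hz _ e1) _ h1.
have n2 := cvgr_le _ (hz _ e2) _ h2.
have n3 := count_bounds eta0 eta1.
near=> x => m cm.
have [c1 c2] : zeta ((1 - eta) * x) - 1 <= m%:R /\ m%:R <= zeta ((1 + 2 * eta) * x).
  by move: m cm; near: x.
have z1 : 2 / eta <= zeta x by near: x; exact: zeta_near.
have z0 : 0 < zeta x by apply: lt_le_trans z1; rewrite divr_gt0.
have z2 : 1 <= eta / 2 * zeta x.
  by rewrite -ler_pdivrMl ?divr_gt0// mulr1 invf_div.
have b1 : (1 - 3 / 2 * eta) * zeta x <= zeta ((1 - eta) * x).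
  by rewrite -ler_pdivlMr//; near: x; exact: n1.
have b2 : zeta ((1 + 2 * eta) * x) <= (1 + 3 * eta) * zeta x.
  by rewrite -ler_pdivrMr//; near: x; exact: n2.
split; lra.
Unshelve. all: by end_near. Qed.

Lemma powR2_gamma : 1 < 2 `^ gamma <= 2.
Proof.
have /andP[g0 g1] := hgamma; apply/andP; split; last by apply: ler1_powR; lra.
by rewrite /powR pnatr_eq0/= expR_gt1 mulr_gt0// ln_gt0//; lra.
Qed.

(** The counts at a and a / 2 inherit the doubling behaviour of zeta at x = 1 / a;
    the three approximations cost at most 16 eta in total, whence eta = eps / 16. *)
Lemma count_ratio eps : 0 < eps -> eps <= 1 ->
  exists2 a0, 0 < a0 & forall a, 0 < a -> a <= a0 ->
  forall m m', is_count a m -> is_count (a / 2) m' ->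
    (2 `^ gamma - eps) * m%:R <= m'%:R /\ m'%:R <= (2 `^ gamma + eps) * m%:R.
Proof.
move=> eps0 eps1; have /andP[g1 g2] := powR2_gamma.
set g := 2 `^ gamma in g1 g2 *.
pose eta := eps / 16.
have eta0 : 0 < eta by rewrite /eta; lra.
have eta1 : eta < 1 by rewrite /eta; lra.
have epsE : eps = 16 * eta by rewrite /eta; field.
have [_ _ hz] := hzeta.
have l1 : g - eta < g by lra.
have l2 : g < g + eta by lra.
have two0 : 0 < 2 :> R by [].
have n1 := cvgr_ge _ (hz _ two0) _ l1.
have n2 := cvgr_le _ (hz _ two0) _ l2.
have n3 := count_asymptotics eta0 eta1.
have [M [_ HM]] : \forall x \near +oo, [/\ (g - eta) * zeta x <= zeta (2 * x),
    zeta (2 * x) <= (g + eta) * zeta x, 0 <= zeta x & forall m, is_count x^-1 m ->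
    (1 - 2 * eta) * zeta x <= m%:R /\ m%:R <= (1 + 3 * eta) * zeta x].
  near=> x.
  have z0 : 0 < zeta x.
    by apply: (@lt_le_trans _ _ 1) => //; near: x; exact: zeta_near.
  split; last by near: x; exact: n3.
  - by rewrite -ler_pdivlMr//; near: x; exact: n1.
  - by rewrite -ler_pdivrMr//; near: x; exact: n2.
  - exact: ltW.
exists (Num.max M 1 + 1)^-1.
  by rewrite invr_gt0 ltr_wpDl// le_max ler01 orbT.
move=> a a0 aM m m' cm cm'.
have Ma : M < a^-1.
  apply: (@lt_le_trans _ _ (Num.max M 1 + 1)).
    by apply: le_lt_trans (_ : M <= Num.max M 1) _; rewrite ?le_max ?lexx// ltrDl.
  rewrite -[leLHS]invrK lef_pV2 ?posrE// invr_gt0 ltr_wpDl// le_max ler01 orbT//.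
have ai0 : 0 < a^-1 by rewrite invr_gt0.
have M2a : M < 2 * a^-1 by lra.
have [h1 h2 z0 h3] := HM _ Ma.
have [_ _ _ h4] := HM _ M2a.
have [c1 c2] := h3 m ltac:(by rewrite invrK).
have [c3 c4] := h4 m' ltac:(by rewrite invfM invrK mulrC).
set z := zeta a^-1 in h1 h2 z0 c1 c2.
set z2 := zeta (2 * a^-1) in h1 h2 c3 c4.
split.
- apply: (@le_trans _ _ ((g - eps) * ((1 + 3 * eta) * z))).
    by rewrite ler_wpM2l// ; lra.
  apply: (le_trans _ c3).
  apply: (@le_trans _ _ ((1 - 2 * eta) * ((g - eta) * z))); last first.
    by rewrite ler_wpM2l// /eta; lra.
  by rewrite !mulrA ler_wpM2r// epsE; nra.
- apply: (@le_trans _ _ ((g + eps) * ((1 - 2 * eta) * z))); last first.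
    by rewrite ler_wpM2l//; lra.
  apply: (le_trans c4).
  apply: (@le_trans _ _ ((1 + 3 * eta) * ((g + eta) * z))).
    by rewrite ler_wpM2l//; lra.
  by rewrite !mulrA ler_wpM2r// epsE; nra.
Unshelve. all: by end_near. Qed.


Lemma exponential_prob_itvoc (t x : R) : 0 < x ->
  exponential_prob t `]0, x] = (1 - expR (- (t * x)))%:E.
Proof.
move=> x0; rewrite EFinB -mulNr -exponential_prob_itv0c// /exponential_prob.
apply: integral_itv_obnd_cbnd.
by apply/measurable_EFinP/measurable_funTS; exact: measurable_exponential_pdf.
Qed.

Lemma mass_gt0 i : 0 < mass p i.+1.
Proof. by case: i => [|i]; [have [h /(lt_le_trans h)] := hp.2 1%N isT|have [] := hp.2 i.+1 isT]. Qed.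

Lemma mean_occupancy_series t : 0 <= t ->
  (\sum_(0 <= i <oo) (occupancy p t i.+1)%:E = (mean_occupancy p t)%:E)%E.
Proof.
move=> t0; apply/cvg_lim => //.
rewrite (_ : (fun n => _) = EFin \o (fun n => \sum_(i < n.+1) occupancy p t i)).
  apply: cvg_EFin; first exact: nearW.
  by have := cvg_mean_occupancy hp t0; rewrite -cvg_shiftS.
apply/funext => n /=; rewrite big_ord_recl occupancy0// add0r -sumEFin big_mkord.
exact: eq_bigr.
Qed.

Lemma series_is_count (c y : R) m : 0 < c -> 0 < y -> is_count (y / c) m ->
  (\sum_(0 <= i <oo) (\1_(`]0%R, c * mass p i.+1] : set R) y : R)%:E = m%:R%:E)%E.
Proof.
move=> c0 y0 cm; apply/cvg_lim => //; apply: cvg_near_cst.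
near=> n.
have mn : (m <= n)%N by near: n; exact: nbhs_infty_ge.
rewrite sumEFin (eq_bigr (fun i => (i < m)%N%:R : R)).
  rewrite (big_cat_nat (n := m))//= [X in (_ + X)%:E]big_nat [X in (_ + X)%:E]big1.
    rewrite addr0 (eq_big_nat _ _ (F2 := fun=> 1)); last by move=> i /andP[_ ->].
    by rewrite sumr_const_nat subn0.
  by move=> i /andP[mi _]; rewrite ltnNge mi.
move=> i _; rewrite indicE; congr (nat_of_bool _)%:R.
rewrite -cm ler_pdivrMr// mulrC; apply/idP/idP.
  by rewrite inE/= in_itv/= y0.
by move=> yc; rewrite inE/= in_itv/= y0.
Unshelve. all: by end_near. Qed.

(** With Y exponentially distributed at rate t, 1 - exp (- t x) is the
    probability that Y <= x, so that mu (c t) is the expected number of indices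
    i with p_i >= Y / c. *)
Lemma mean_occupancy_comparison (c c' k C t : R) :
  0 < c -> 0 < c' -> 0 <= k -> 0 <= C -> 0 < t ->
  (forall y, 0 < y -> forall m m', is_count (y / c) m -> is_count (y / c') m' ->
    m%:R <= k * m'%:R + C) ->
  mean_occupancy p (c * t) <= k * mean_occupancy p (c' * t) + C.
Proof.
move=> c0 c'0 k0 C0 t0 H.
pose A e i : set R := `]0, e * mass p i.+1]%classic.
(* this probability measure depends on the proof of 0 < t, so that it cannot be
   inferred from exponential_prob t *)
have := @nneseries_measure_le _ _ _
  (exponential_distribution_exponential_prob__canonical__probability_measure_Probability t0)
  (A c) (A c') k C.
have QA e i : 0 < e -> exponential_prob t (A e i) = (occupancy p (e * t) i.+1)%:E.
  move=> e0; rewrite exponential_prob_itvoc; last by rewrite mulr_gt0// mass_gt0.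
  by rewrite /occupancy mulrA (mulrC t).
have SA e : 0 < e ->
    (\sum_(0 <= i <oo) exponential_prob t (A e i) = (mean_occupancy p (e * t))%:E)%E.
  move=> e0; rewrite -mean_occupancy_series; last by rewrite mulr_ge0// ltW.
  by apply: eq_eseriesr => i _; exact: QA.
rewrite /= !SA// -EFinM -EFinD lee_fin; apply => //.
- by move=> i; exact: measurable_itv.
- by move=> i; exact: measurable_itv.
move=> y; have [y0|y0] := ltP 0 y.
  have [m cm] := is_count_exists (divr_gt0 y0 c0).
  have [m' cm'] := is_count_exists (divr_gt0 y0 c'0).
  rewrite (series_is_count c0 y0 cm) (series_is_count c'0 y0 cm').
  by rewrite -EFinM -EFinD lee_fin; exact: (H y y0 m m' cm cm').
have A0 e : (\sum_(0 <= i <oo) (\1_(A e i) y : R)%:E = 0)%E.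
  apply: eseries0 => i _ _; rewrite indicE memNset//= /A /= in_itv/= ltNge y0//.
by rewrite !A0 mule0 add0e lee_fin.
Qed.

(** Beyond a0 the counting functions are bounded by their value at a0 / 2, which
    is the additive constant C. *)
Lemma mean_occupancy_doubling eps : 0 < eps -> eps <= 1 -> eps < 2 `^ gamma ->
  exists2 C, 0 <= C & forall t, 0 < t ->
    mean_occupancy p (2 * t) <= (2 `^ gamma + eps) * mean_occupancy p t + C /\
    mean_occupancy p t <= (2 `^ gamma - eps)^-1 * mean_occupancy p (2 * t) + C.
Proof.
move=> eps0 eps1 epsg; have /andP[g1 g2] := powR2_gamma.
have [a0 a00 Ha] := count_ratio eps0 eps1.
have a020 : 0 < a0 / 2 by lra.
have [m0 cm0] := is_count_exists a020.
have two0 : 0 < 2 :> R by [].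
have ge0 : 0 < 2 `^ gamma - eps by lra.
exists m0%:R => // t t0; split.
- have := @mean_occupancy_comparison 2 1 (2 `^ gamma + eps) m0%:R t.
  rewrite mul1r; apply => //; first by lra.
  move=> y y0 m' m cm'; rewrite divr1 => cm.
  have [ya|ay] := leP y a0.
    have [_ h] := Ha y y0 ya m m' cm cm'.
    by apply: (le_trans h); rewrite lerDl.
  have : (m' <= m0)%N by apply: is_count_le cm' cm0; lra.
  rewrite -(ler_nat R) => /le_trans; apply; rewrite lerDr mulr_ge0//; lra.
- have := @mean_occupancy_comparison 1 2 (2 `^ gamma - eps)^-1 m0%:R t.
  rewrite mul1r; apply => //; first by rewrite invr_ge0 ltW.
  move=> y y0 m m'; rewrite divr1 => cm cm'.
  have [ya|ay] := leP y a0.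
    have [h _] := Ha y y0 ya m m' cm cm'.
    rewrite -(ler_pM2l ge0) mulrDr mulrA divff ?gt_eqF// mul1r.
    by apply: (le_trans h); rewrite lerDl mulr_ge0// ltW.
  have : (m <= m0)%N by apply: is_count_le cm cm0; lra.
  by rewrite -(ler_nat R) => /le_trans; apply; rewrite lerDr mulr_ge0// invr_ge0 ltW.
Qed.

Lemma cvg_occupancy_variance_ratio :
  mean_occupancy p n%:R @[n --> \oo] --> +oo ->
  occupancy_variance p n%:R / mean_occupancy p n%:R @[n --> \oo]
    --> 2 `^ gamma - 1.
Proof.
move=> muy; have /andP[g1 g2] := powR2_gamma.
apply/cvgrPdist_le => e e0.
pose eps := Num.min (e / 3) 1.
have eps0 : 0 < eps by rewrite lt_min ltr01 andbT; lra.
have eps1 : eps <= 1 by rewrite ge_min lexx orbT.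
have epse : eps <= e / 3 by rewrite ge_min lexx.
have epsg : eps < 2 `^ gamma by lra.
have [C C0 HC] := mean_occupancy_doubling eps0 eps1 epsg.
near=> n.
have n0 : 0 < n%:R :> R by rewrite ltr0n; near: n; exact: nbhs_infty_gt.
have m1 : C / eps + 1 <= mean_occupancy p n%:R.
  by near: n; move/cvgryPge : muy; exact.
have [h1 h2] := HC _ n0.
rewrite /occupancy_variance.
set m := mean_occupancy p n%:R in m1 h1 h2 *.
set M := mean_occupancy p (2 * n%:R) in h1 h2 *.
have ce0 : 0 <= C / eps by rewrite divr_ge0// ltW.
have m0 : 0 < m by lra.
have Cm : C <= eps * m by rewrite -ler_pdivrMl// mulrC; lra.
have ge0 : 0 < 2 `^ gamma - eps by lra.
have h3 : (2 `^ gamma - eps) * m <= M + (2 `^ gamma - eps) * C.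
  by rewrite -(ler_pM2l ge0) mulrDr mulrA divff ?gt_eqF// mul1r in h2.
have h4 : (2 `^ gamma - eps) * C <= 2 * C by rewrite ler_wpM2r//; lra.
rewrite -(ler_pM2r m0) -[X in _ * X <= _](gtr0_norm m0) -normrM.
rewrite mulrBl divfK ?gt_eqF//.
have he : eps * m <= e / 3 * m by rewrite ler_pM2r.
rewrite ler_norml; apply/andP; split; lra.
Unshelve. all: by end_near. Qed.

End RegularVariation.

(** * Large deviations from quadratic cumulants *)

Section LimitsOfRates.
Set Implicit Arguments.
Unset Strict Implicit.
Unset Printing Implicit Defensive.
Context (R : realType).
Local Open Scope ereal_scope.
Implicit Types (u : (\bar R)^nat) (x : \bar R).

Lemma limn_esup_le_near u x : (\forall n \near \oo, u n <= x) -> limn_esup u <= x.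
Proof.
move=> ux; apply: (@le_trans _ _ (ereal_sup [set u n | n in [set n | u n <= x]])).
  by apply: ereal_inf_lbound; exists [set n | u n <= x].
by apply: ge_ereal_sup => _ [n /= unx <-].
Qed.

Lemma limn_einf_ge_near u x : (\forall n \near \oo, x <= u n) -> x <= limn_einf u.
Proof.
move=> ux; rewrite /limn_einf leeNr; apply: limn_esup_le_near.
by apply: filterS ux => n /=; rewrite leeN2.
Qed.

Lemma lte_real_between (x y : \bar R) : x < y -> exists2 r : R, x < r%:E & r%:E < y.
Proof.
case: x => [x| |]; case: y => [y| |]//.
- rewrite lte_fin => xy; exists ((x + y) / 2)%R; rewrite lte_fin; lra.
- by move=> _; exists (x + 1)%R; rewrite ?ltry// lte_fin ltrDl.
- by move=> _; exists (y - 1)%R; rewrite ?ltNyr// lte_fin gtrBl.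
- by move=> _; exists 0%R; rewrite ?ltry ?ltNyr.
Qed.

Lemma rate_le (b y : R) x : (0 < b)%R -> 0 <= x -> x <= (expR y)%:E ->
  b^-1%:E * lne x <= (b^-1 * y)%:E.
Proof.
move=> b0 x0 xy; rewrite EFinM; apply: lee_wpmul2l.
  by rewrite lee_fin invr_ge0 ltW.
rewrite -[y%:E]expeRK /=; apply: le_trans (_ : lne (expR y)%:E <= _) => //.
by rewrite lee_lne// in_itv/= ?x0 ?leey// lee_fin expR_ge0.
Qed.

Lemma rate_ge (b y : R) x : (0 < b)%R -> (expR y)%:E <= x ->
  (b^-1 * y)%:E <= b^-1%:E * lne x.
Proof.
move=> b0 xy; rewrite EFinM; apply: lee_wpmul2l.
  by rewrite lee_fin invr_ge0 ltW.
have x0 : 0 <= x by apply: le_trans xy; rewrite lee_fin expR_ge0.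
rewrite -[y%:E]expeRK /=; apply: le_trans (_ : lne (expR y)%:E <= _) => //.
by rewrite lee_lne// in_itv/= ?x0 ?leey// lee_fin expR_ge0.
Qed.

End LimitsOfRates.

Lemma sqr_dominates (R : realType) (E q M X u w : R) : 2 <= E -> 0 <= q ->
  E ^+ 2 * q <= M -> M <= X + u + w -> u <= q -> w <= q -> E * q <= X.
Proof.
move=> E2 q0 EM MX uq wq.
have EE : E + 2 <= E ^+ 2 by nra.
by have := ler_wpM2r q0 EE; lra.
Qed.

(** Tilting without a change of measure: outside ]x - dl, x + dl[ the weight
    exp (la B z) is dominated by the weights at la + h and la - h, which the
    factors exp (- h dl B) make small when h dl exceeds the increase of the
    cumulants. *)
Lemma expR_le_tilted (R : realType) (x dl la h B z : R) : 0 <= h -> 0 <= B ->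
  expR (la * B * z) <=
  expR ((la * x + `|la| * dl) * B) * (`|z - x| < dl)%R%:R
  + expR (- (h * (x + dl) * B)) * expR ((la + h) * B * z)
  + expR (h * (x - dl) * B) * expR ((la - h) * B * z).
Proof.
move=> h0 B0; have hB0 : 0 <= h * B by exact: mulr_ge0.
rewrite -!expRD.
have p0 : 0 <= expR ((la * x + `|la| * dl) * B) * (`|z - x| < dl)%R%:R.
  by rewrite mulr_ge0 ?expR_ge0.
have [zx|zx] := leP (x + dl) z.
  apply: le_trans (_ : expR (- (h * (x + dl) * B) + (la + h) * B * z) <= _).
    by rewrite ler_expR; have := ler_wpM2l hB0 zx; lra.
  by rewrite -addrA addrCA lerDl addr_ge0// expR_ge0.
have [xz|xz] := leP z (x - dl).
  apply: le_trans (_ : expR (h * (x - dl) * B + (la - h) * B * z) <= _).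
    by rewrite ler_expR; have := ler_wpM2l hB0 xz; lra.
  by rewrite lerDr addr_ge0// expR_ge0.
have zdl : `|z - x| < dl by rewrite ltr_norml; apply/andP; split; lra.
rewrite -addrA zdl mulr1.
apply: le_trans (_ : expR ((la * x + `|la| * dl) * B) <= _); last first.
  by rewrite lerDl addr_ge0// expR_ge0.
rewrite ler_expR mulrAC ler_wpM2r//.
have -> : la * z = la * x + la * (z - x) by ring.
by rewrite lerD2l (le_trans (ler_norm _))// normrM ler_wpM2l// ltW.
Qed.

Section QuadraticLargeDeviations.
Set Implicit Arguments.
Unset Strict Implicit.
Unset Printing Implicit Defensive.
Context (R : realType) (d : measure_display) (T : measurableType d).
Variables (P : probability T R) (Z : nat -> T -> R) (b : nat -> R) (v : R).
Hypothesis mZ : forall n, measurable_fun setT (Z n).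
Hypothesis v0 : 0 < v.
Hypothesis hb0 : forall n : nat, (1 <= n)%N -> 0 < b n.
Hypothesis hb : b n @[n --> \oo] --> +oo.
Hypothesis iZ : forall n (la : R),
  P.-integrable setT (EFin \o (fun w => expR (la * b n * Z n w))).
Hypothesis hupper : forall la eps : R, 0 < eps -> \forall n \near \oo,
  \int[P]_w expR (la * b n * Z n w) <= expR ((la ^+ 2 / 2 * v + eps) * b n).
Hypothesis hlower : forall la eps : R, 0 < eps -> eps <= 1 -> \forall n \near \oo,
  expR ((la ^+ 2 / 2 * v - eps) * b n) <= \int[P]_w expR (la * b n * Z n w).

Let mgf n la := \int[P]_w expR (la * b n * Z n w).

Let iZscaled n la k : P.-integrable setT
  (EFin \o (fun w => k * expR (la * b n * Z n w))).
Proof. exact: (integrableZl measurableT k (iZ n la)). Qed.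

(** Chernoff's bound at la = r / v, the minimizer of la^2 v / 2 - la r; the
    indicator is bounded by the sum of the two exponentials. *)
Lemma quadratic_ldp_upper (r eps : R) : 0 <= r -> 0 < eps -> \forall n \near \oo,
  (P [set w | (r <= `|Z n w|)%R] <= (expR ((eps - r ^+ 2 / (2 * v)) * b n))%:E)%E.
Proof.
move=> r0 eps0; pose la := r / v.
have la0 : 0 <= la by rewrite divr_ge0// ltW.
have e2 : 0 < eps / 2 by lra.
near=> n.
have n0 : (1 <= n)%N by near: n; exact: nbhs_infty_gt.
have bn0 := hb0 n0.
have b2 : 2 / eps <= b n by near: n; move/cvgryPge : hb; exact.
have b2e : 1 <= eps / 2 * b n.
  by rewrite -ler_pdivrMl// mulr1 invf_div.
have h1 : mgf n la <= expR ((la ^+ 2 / 2 * v + eps / 2) * b n).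
  by near: n; exact: hupper.
have h2 : mgf n (- la) <= expR (((- la) ^+ 2 / 2 * v + eps / 2) * b n).
  by near: n; exact: hupper.
have mA : measurable [set w | r <= `|Z n w|].
  have -> : [set w | r <= `|Z n w|] = ~` (Z n @^-1` (ball 0 r)).
    apply/seteqP; split=> w /=; rewrite /ball/= sub0r normrN leNgt.
      by move=> /negP.
    by move=> /negP.
  apply: measurableC; rewrite -[X in measurable X]setTI.
  by apply: mZ => //; exact: measurable_ball.
set A := [set w | _] in mA *.
have -> : P A = (\int[P]_w (\1_A w)%:E)%E by rewrite integral_indic// setIT.
set k := expR (- (la * r * b n)).
have i1 := iZscaled n la k; have i2 := iZscaled n (- la) k.
apply: (@le_trans _ _ (\int[P]_w
   ((k * expR (la * b n * Z n w))%:E + (k * expR (- la * b n * Z n w))%:E))%E).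
  apply: ge0_le_integral => //.
  - by apply/measurable_EFinP; exact: measurable_indic.
  - by have /measurable_int := integrableD measurableT i1 i2.
  move=> w _; rewrite -EFinD lee_fin indicE.
  have p1 : 0 <= k * expR (la * b n * Z n w) by rewrite mulr_ge0// expR_ge0.
  have p2 : 0 <= k * expR (- la * b n * Z n w) by rewrite mulr_ge0// expR_ge0.
  case: (boolP (w \in _)) => [|_]; last by rewrite /=; lra.
  rewrite inE => rZ; have {}rZ : r <= `|Z n w| := rZ.
  have lab0 : 0 <= la * b n by rewrite mulr_ge0// ltW.
  have [Z0|Z0] := leP 0 (Z n w).
    have : 1 <= k * expR (la * b n * Z n w).
      rewrite /k -expRD -[leLHS]expR0 ler_expR.
      by rewrite ger0_norm// in rZ; nra.
    by rewrite /=; lra.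
  have : 1 <= k * expR (- la * b n * Z n w).
    rewrite /k -expRD -[leLHS]expR0 ler_expR.
    by rewrite ltr0_norm// in rZ; nra.
  by rewrite /=; lra.
rewrite integralD//.
have E1 la' : (\int[P]_w (k * expR (la' * b n * Z n w))%:E = (k * mgf n la')%:E)%E.
  rewrite -RintegralZl// fineK//.
  by apply: integrable_fin_num => //; exact: iZscaled.
rewrite !E1 -EFinD lee_fin -mulrDr.
rewrite sqrrN in h2.
apply: (@le_trans _ _ (k * (2 * expR ((la ^+ 2 / 2 * v + eps / 2) * b n)))).
  by rewrite ler_wpM2l ?expR_ge0//; lra.
apply: (@le_trans _ _ (k * (expR (eps / 2 * b n) *
    expR ((la ^+ 2 / 2 * v + eps / 2) * b n)))).
  by rewrite ler_wpM2l ?expR_ge0// ler_wpM2r ?expR_ge0// expR1_ge2.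
rewrite /k -!expRD ler_expR le_eqVlt; apply/orP; left; apply/eqP.
by rewrite /la; field; rewrite gt_eqF.
Unshelve. all: by end_near. Qed.

Lemma quadratic_ldp_lower_ball (x dl : R) : 0 < dl -> dl ^+ 2 <= 8 * v ->
  \forall n \near \oo,
  ((expR (- (x ^+ 2 / (2 * v) + `|x| * dl / v + dl ^+ 2 / (4 * v)) * b n))%:E
    <= P [set w | (`|Z n w - x| < dl)%R])%E.
Proof.
move=> dl0 dlv; pose la := x / v; pose h := dl / v; pose eps := dl ^+ 2 / (8 * v).
have h0 : 0 < h by rewrite divr_gt0.
have v80 : 0 < 8 * v by rewrite mulr_gt0.
have eps0 : 0 < eps by rewrite divr_gt0// exprn_gt0.
have eps1 : eps <= 1 by rewrite /eps ler_pdivrMr// mul1r.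
near=> n.
have n0 : (1 <= n)%N by near: n; exact: nbhs_infty_gt.
have bn0 := hb0 n0.
have b2 : eps^-1 <= b n by near: n; move/cvgryPge : hb; exact.
have b2e : 1 <= eps * b n by rewrite -ler_pdivrMl// mulr1.
have h1 : expR ((la ^+ 2 / 2 * v - eps) * b n) <= mgf n la.
  by near: n; exact: hlower.
have h2 : mgf n (la + h) <= expR (((la + h) ^+ 2 / 2 * v + eps) * b n).
  by near: n; exact: hupper.
have h3 : mgf n (la - h) <= expR (((la - h) ^+ 2 / 2 * v + eps) * b n).
  by near: n; exact: hupper.
set A := [set w | _].
have mA : measurable A.
  have -> : A = Z n @^-1` (ball x dl).
    by apply/seteqP; split=> w; rewrite /A /= /ball/= distrC.
  by rewrite -[X in measurable X]setTI; apply: mZ => //; exact: measurable_ball.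
have PAfin : P A \is a fin_num by exact: fin_num_measure.
set k1 := expR ((la * x + `|la| * dl) * b n).
set k2 := expR (- (h * (x + dl) * b n)).
set k3 := expR (h * (x - dl) * b n).
have i0 : P.-integrable setT (EFin \o (fun w => k1 * \1_A w)).
  exact: (integrableZl measurableT k1 (integrable_indic P mA)).
have i2 := iZscaled n (la + h) k2; have i3 := iZscaled n (la - h) k3.
have i02 : P.-integrable setT
    (EFin \o (fun w => k1 * \1_A w + k2 * expR ((la + h) * b n * Z n w))).
  exact: (integrableD measurableT i0 i2).
have key : mgf n la <= k1 * fine (P A) + k2 * mgf n (la + h) + k3 * mgf n (la - h).
  have -> : fine (P A) = \int[P]_w \1_A w.
    by rewrite /Rintegral integral_indic// setIT.
  rewrite -!RintegralZl//; last exact: integrable_indic.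
  rewrite -!RintegralD//.
  apply: le_Rintegral => //; first exact: (integrableD measurableT i02 i3).
  move=> w _ /=.
  rewrite (_ : \1_A w = (`|Z n w - x| < dl)%R%:R).
    by apply: expR_le_tilted; [exact: ltW|exact: ltW].
  rewrite indicE; congr (nat_of_bool _)%:R; apply/idP/idP; first by rewrite inE.
  by move=> zx; rewrite inE.
have lav : la * v = x by rewrite /la divfK// gt_eqF.
have hv : h * v = dl by rewrite /h divfK// gt_eqF.
have epsE : h * dl = 8 * eps by rewrite /eps /h; field; rewrite gt_eqF.
have hhv : h ^+ 2 * v = 8 * eps by rewrite expr2 -mulrA hv.
set L := la ^+ 2 / 2 * v in h1 h2 h3.
have t2 : k2 * mgf n (la + h) <= expR ((L - 3 * eps) * b n).
  apply: (@le_trans _ _ (k2 * expR (((la + h) ^+ 2 / 2 * v + eps) * b n))).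
    by rewrite ler_wpM2l// expR_ge0.
  rewrite /k2 -expRD ler_expR -mulNr -mulrDl ler_wpM2r ?(ltW bn0)//.
  rewrite le_eqVlt; apply/orP; left; apply/eqP.
  have -> : - (h * (x + dl)) + ((la + h) ^+ 2 / 2 * v + eps) =
    L + h * (la * v - x) + (h ^+ 2 * v / 2 - h * dl + eps) by rewrite /L; field.
  by rewrite lav epsE hhv; field.
have t3 : k3 * mgf n (la - h) <= expR ((L - 3 * eps) * b n).
  apply: (@le_trans _ _ (k3 * expR (((la - h) ^+ 2 / 2 * v + eps) * b n))).
    by rewrite ler_wpM2l// expR_ge0.
  rewrite /k3 -expRD ler_expR -mulrDl ler_wpM2r ?(ltW bn0)//.
  rewrite le_eqVlt; apply/orP; left; apply/eqP.
  have -> : h * (x - dl) + ((la - h) ^+ 2 / 2 * v + eps) =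
    L - h * (la * v - x) + (h ^+ 2 * v / 2 - h * dl + eps) by rewrite /L; field.
  by rewrite lav epsE hhv; field.
set q := expR ((L - 3 * eps) * b n) in t2 t3.
have qe y : expR ((L - 3 * eps + y) * b n) = expR (y * b n) * q.
  by rewrite /q -expRD; congr expR; ring.
have q0 : 0 < q by exact: expR_gt0.
have e2 : 2 <= expR (eps * b n) by exact: expR1_ge2.
have ee : expR (2 * eps * b n) = expR (eps * b n) ^+ 2.
  by rewrite -expRM_natl mulrA.
have main : expR ((L - 2 * eps) * b n) <= k1 * fine (P A).
  have -> : L - 2 * eps = L - 3 * eps + eps by ring.
  move: h1; have -> : L - eps = L - 3 * eps + 2 * eps by ring.
  by rewrite !qe ee => h1; apply: (sqr_dominates e2 (ltW q0) h1 key).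
have -> : P A = (fine (P A))%:E by rewrite fineK.
rewrite lee_fin -(ler_pM2l (expR_gt0 ((la * x + `|la| * dl) * b n))).
apply: le_trans main; rewrite -expRD ler_expR -mulrDl ler_wpM2r ?(ltW bn0)//.
have vn : `|la| = `|x| / v by rewrite /la normrM normfV (gtr0_norm v0).
rewrite le_eqVlt; apply/orP; left; apply/eqP.
by rewrite /L /eps vn /la; field; rewrite gt_eqF.
Unshelve. all: by end_near. Qed.


Lemma quadratic_ldp_lower x dl eps : 0 < dl -> 0 < eps ->
  \forall n \near \oo,
  ((expR (- (x ^+ 2 / (2 * v) + eps) * b n))%:E
    <= P [set w | (`|Z n w - x| < dl)%R])%E.
Proof.
move=> dl0 eps0.
(* dl is shrunk to e so that the error terms of the previous bound total at most eps *)
pose D := 1 + v^-1 * (1 + `|x|) / eps + v^-1.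
have vi0 : 0 < v^-1 by rewrite invr_gt0.
have x0 := normr_ge0 x.
have q0 : 0 <= v^-1 * (1 + `|x|) / eps.
  by rewrite divr_ge0 ?(ltW eps0)// mulr_ge0 ?(ltW vi0)//; lra.
have D0 : 0 < D by rewrite /D; lra.
pose e := Num.min dl D^-1.
have e0 : 0 < e by rewrite lt_min dl0 invr_gt0.
have edl : e <= dl by rewrite ge_min lexx.
have eD : e * D <= 1 by rewrite -ler_pdivlMr// div1r ge_min lexx orbT.
have h1 : e * (v^-1 * (1 + `|x|) / eps) <= 1.
  by apply: le_trans eD; rewrite ler_pM2l// /D; lra.
have h2 : e * v^-1 <= 1.
  by apply: le_trans eD; rewrite ler_pM2l// /D; lra.
have h3 : e <= 1.
  by apply: le_trans eD; rewrite -[leLHS]mulr1 ler_pM2l// /D; lra.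
have ev : e <= v by rewrite -[leRHS]mul1r -ler_pdivrMr.
have e8 : e ^+ 2 <= 8 * v by rewrite expr2; nra.
have h4 : e * (v^-1 * (1 + `|x|)) <= eps.
  by rewrite -[leRHS]mul1r -ler_pdivrMr// -mulrA.
have := quadratic_ldp_lower_ball x e0 e8.
apply: filterS2 (nbhs_infty_gt 0) => n n0.
have bn0 := hb0 n0.
have mball r : measurable [set w | (`|Z n w - x| < r)%R].
  have -> : [set w | `|Z n w - x| < r] = Z n @^-1` (ball x r).
    by apply/seteqP; split=> w; rewrite /ball/= distrC.
  by rewrite -[X in measurable X]setTI; apply: mZ => //; exact: measurable_ball.
move=> h; apply: (@le_trans _ _ (P [set w | (`|Z n w - x| < e)%R])); last first.
  by apply: le_measure; rewrite ?inE// => w /= /lt_le_trans; exact.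
apply: le_trans h; rewrite lee_fin ler_expR ler_wpM2r ?(ltW bn0)// lerN2.
rewrite -addrA lerD2l.
have -> : `|x| * e / v + e ^+ 2 / (4 * v) = e * (v^-1 * (`|x| + e / 4)).
  by field; rewrite gt_eqF.
apply: le_trans h4; rewrite ler_pM2l// ler_pM2l//; lra.
Qed.

Lemma quadratic_ldp_upper_set (B : set R) : measurable B ->
  (limn_esup (fun n => (b n)^-1%:E * lne (P (Z n @^-1` B)))
    <= - ((2 * v)^-1%:E * ereal_inf [set (x ^+ 2)%:E | x in closure B]))%E.
Proof.
move=> mB; set I := ereal_inf _; set L := limn_esup _.
have c0 : 0 < (2 * v)^-1 by rewrite invr_gt0 mulr_gt0.
have near_rate (y : R) : (\forall n \near \oo, P (Z n @^-1` B) <= (expR (y * b n))%:E)%E ->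
    (L <= y%:E)%E.
  move=> h; apply: limn_esup_le_near.
  apply: filterS2 (nbhs_infty_gt 0) h => n n0 h.
  have bn0 := hb0 n0.
  have -> : y = (b n)^-1 * (y * b n) by rewrite mulrC mulfK// gt_eqF.
  exact: rate_le.
have key (u : R) : (u%:E < I)%E -> (L <= (- ((2 * v)^-1 * u))%:E)%E.
  move=> uI; apply/lee_addgt0Pr => eps eps0.
  rewrite -EFinD; apply: near_rate.
  have [u0|u0] := leP u 0.
    apply: filterS (nbhs_infty_gt 0) => n n0; have bn0 := hb0 n0.
    apply: le_trans (probability_le1 _ _) _.
      by rewrite -[X in measurable X]setTI; exact: mZ.
    rewrite lee_fin -[leLHS]expR0 ler_expR mulr_ge0 ?(ltW bn0)// addr_ge0 ?(ltW eps0)//.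
    by rewrite -mulrN mulr_ge0 ?(ltW c0)// oppr_ge0.
  have su0 := sqrtr_ge0 u.
  have := quadratic_ldp_upper su0 eps0; apply: filterS => n.
  have su2 : Num.sqrt u ^+ 2 = u by rewrite sqr_sqrtr// ltW.
  rewrite su2 addrC [(2 * v)^-1 * u]mulrC => /(le_trans _); apply.
  apply: le_measure; rewrite ?inE//.
  - by rewrite -[X in measurable X]setTI; exact: mZ.
  - have -> : [set w | Num.sqrt u <= `|Z n w|] = ~` (Z n @^-1` (ball 0 (Num.sqrt u))).
      by apply/seteqP; split=> w /=; rewrite /ball/= sub0r normrN leNgt => /negP.
    apply: measurableC; rewrite -[X in measurable X]setTI.
    by apply: mZ => //; exact: measurable_ball.
  move=> w /= Bw.
  have : (I <= (Z n w ^+ 2)%:E)%E.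
    by apply: ereal_inf_lbound; exists (Z n w) => //; exact: subset_closure.
  move=> /(lt_le_trans uI); rewrite lte_fin => uZ.
  by rewrite -sqrtr_sqr ler_wsqrtr// ltW.
rewrite leeNr -lee_pdivlMl// leNgt; apply/negP => h.
have [u uL uI] := lte_real_between h.
by move: uL; apply/negP; rewrite -leNgt lee_pdivlMl// leeNr -EFinM -EFinN; exact: key.
Qed.

Lemma quadratic_ldp_lower_set (B : set R) : measurable B ->
  (- ((2 * v)^-1%:E * ereal_inf [set (x ^+ 2)%:E | x in interior B])
    <= limn_einf (fun n => (b n)^-1%:E * lne (P (Z n @^-1` B))))%E.
Proof.
move=> mB; set L := limn_einf _.
have c0 : 0 < (2 * v)^-1 by rewrite invr_gt0 mulr_gt0.
rewrite leeNl -lee_pdivrMl//; apply: le_ereal_inf_tmp => _ [x Bx <-].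
rewrite lee_pdivrMl// leeNl; apply/lee_subgt0Pr => eps eps0.
have [dl dl0 dlB] : exists2 dl : R, 0 < dl & ball x dl `<=` B.
  by have /nbhs_ballP[dl dl0 dlB] := Bx; exists dl.
apply: limn_einf_ge_near; have := quadratic_ldp_lower x dl0 eps0.
apply: filterS2 (nbhs_infty_gt 0) => n n0 h; have bn0 := hb0 n0.
rewrite -EFinM -EFinN -EFinB.
have -> : - ((2 * v)^-1 * x ^+ 2) - eps = (b n)^-1 * (- (x ^+ 2 / (2 * v) + eps) * b n).
  by field; rewrite !gt_eqF.
apply: rate_ge => //; apply: (le_trans h).
apply: le_measure; rewrite ?inE//.
- have -> : [set w | `|Z n w - x| < dl] = Z n @^-1` (ball x dl).
    by apply/seteqP; split=> w; rewrite /ball/= distrC.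
  by rewrite -[X in measurable X]setTI; apply: mZ => //; exact: measurable_ball.
- by rewrite -[X in measurable X]setTI; exact: mZ.
by move=> w /= Zx; apply: dlB; rewrite /ball/= distrC.
Qed.

End QuadraticLargeDeviations.

(** * The moderate deviation principle *)

Theorem theorem1p2 (R : realType) (d : measure_display) (T : measurableType d)
    (P : probability T R) (p : probability nat R)
    (xi : nat -> {RV P >-> nat}) (b : nat -> R) (gamma : R)
    (hp : nonincreasing_positive_law p)
    (hxi : iid_with_law p xi)
    (hb0 : forall n : nat, (1 <= n)%N -> 0 < b n)
    (hb : b n @[n --> \oo] --> +oo)
    (hmub : mean_occupancy p n%:R / b n @[n --> \oo] --> +oo)
    (hgamma : 0 < gamma < 1)
    (hreg : regular_law gamma p)
    (B : set R) (mB : measurable B) :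
  let Z := Zscaled p b xi in
  let c : R := (2 * (2 `^ gamma - 1))^-1 in
  let rate (n : nat) : \bar R := ((b n)^-1%:E * lne (P (Z n @^-1` B)))%E in
  [/\ (- (c%:E * ereal_inf [set (x ^+ 2)%:E | x in interior B])
        <= limn_einf rate)%E,
      (limn_einf rate <= limn_esup rate)%E &
      (limn_esup rate
        <= - (c%:E * ereal_inf [set (x ^+ 2)%:E | x in closure B]))%E].
Proof.
have [zeta hzeta hinv] := hreg.
have /andP[g1 _] := powR2_gamma hgamma.
pose v : R := 2 `^ gamma - 1.
have v0 : 0 < v by rewrite subr_gt0.
have muy : mean_occupancy p n%:R @[n --> \oo] --> +oo.
  apply/cvgryPge => A.
  near=> n.
  have n0 : (1 <= n)%N by near: n; exact: nbhs_infty_gt.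
  have bn0 := hb0 n n0.
  have bA : `|A| <= b n by near: n; move/cvgryPge : hb; exact.
  have m1 : 1 <= mean_occupancy p n%:R / b n by near: n; move/cvgryPge : hmub; exact.
  rewrite ler_pdivlMr// mul1r in m1.
  by rewrite (le_trans (ler_norm _))// (le_trans bA).
have hvar := cvg_occupancy_variance_ratio hp hgamma hzeta hinv muy.
move=> Z c rate.
pose s n (la : R) := la * (b n / Num.sqrt (mean_occupancy p n%:R * b n)).
have ZE n la w : la * b n * Z n w =
    - (s n la * mean_occupancy p n%:R) + s n la * (range_count xi n w)%:R.
  by rewrite /Z /Zscaled /s; ring.
have mZ n : measurable_fun setT (Z n).
  rewrite /Z /Zscaled; apply: measurable_funM => //; apply: measurable_funB => //.
  exact: measurable_range_count.
have iZ n (la : R) : P.-integrable setT (EFin \o (fun w => expR (la * b n * Z n w))).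
  rewrite (_ : (fun w => _) = (fun w => expR (- (s n la * mean_occupancy p n%:R)) *
      expR (s n la * (range_count xi n w)%:R))).
    exact: (integrableZl measurableT _ (integrable_range_mgf xi n (s n la))).
  by apply/funext => w; rewrite ZE expRD.
have mgfE n la : \int[P]_w expR (la * b n * Z n w) =
    expR (- (s n la * mean_occupancy p n%:R)) * range_mgf xi n (s n la).
  rewrite /range_mgf -RintegralZl//; last exact: integrable_range_mgf.
  by apply: eq_Rintegral => w _; rewrite ZE expRD.
have sE : \forall n \near \oo, forall la, s n la = la * mgf_scale p b n.
  near=> n; move=> la.
  have n0 : (1 <= n)%N by near: n; exact: nbhs_infty_gt.
  have bn0 := hb0 n n0.
  have m0 : 1 <= mean_occupancy p n%:R by near: n; move/cvgryPge : muy; exact.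
  have {}m0 : 0 < mean_occupancy p n%:R by apply: lt_le_trans m0.
  rewrite /s /mgf_scale sqrtrM ?(ltW m0)// sqrtrM ?(ltW bn0)// sqrtrV ?(ltW m0)//.
  rewrite -{1}(sqr_sqrtr (ltW bn0)); congr (_ * _); field.
  by rewrite !gt_eqF ?sqrtr_gt0.
have hupper la eps : 0 < eps -> \forall n \near \oo,
    \int[P]_w expR (la * b n * Z n w) <= expR ((la ^+ 2 / 2 * v + eps) * b n).
  move=> eps0.
  have := mgf_near_upper hp hxi hb0 hb hmub hvar la eps0.
  apply: filterS2 sE => n sEn h; rewrite mgfE sEn.
  rewrite -(ler_pM2l (expR_gt0 (la * mgf_scale p b n * mean_occupancy p n%:R))).
  by rewrite mulrA -!expRD subrr expR0 mul1r.
have hlower la eps : 0 < eps -> eps <= 1 -> \forall n \near \oo,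
    expR ((la ^+ 2 / 2 * v - eps) * b n) <= \int[P]_w expR (la * b n * Z n w).
  move=> eps0 eps1.
  have := mgf_near_lower hp hxi hb0 hb hmub hvar (ltW v0) la eps0 eps1.
  apply: filterS2 sE => n sEn h; rewrite mgfE sEn.
  rewrite -(ler_pM2l (expR_gt0 (la * mgf_scale p b n * mean_occupancy p n%:R))).
  by rewrite mulrA -!expRD subrr expR0 mul1r.
split.
- exact: (quadratic_ldp_lower_set mZ v0 hb0 hb iZ hupper hlower mB).
- exact: limn_einf_sup.
- exact: (quadratic_ldp_upper_set mZ v0 hb0 hb iZ hupper mB).
Unshelve. all: by end_near. Qed.
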